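(* Let $(\mathcal{X},\mathcal{F},m)$ be a probability space with $\mathcal{X}$ Polish, and let $(\mathcal{E},\mathbb{D})$ be a conservative, local (diffusion type) Dirichlet form on $L^2(\mathcal{X};m)$ with associated Markov semigroup $(T_t)_{t\ge0}$ and associated Markov process $(X_t)$ with continuous paths, realized on $\Omega=\mathcal{C}([0,1],\mathcal{X})$ with $X_t(\omega)=\omega(t)$ and law $\mathbb{P}$ (initial distribution $m$). Let $\Delta=\{0=t_0<t_1<\dots<t_n=1\}$ be a partition of $[0,1]$ and $A_0,A_1,\dots,A_n$ measurable subsets of $\mathcal{X}$, and let $\mathcal{A}_\Delta=\{\gamma\in\mathcal{C}([0,1],\mathcal{X}) : \gamma(t_i)\in A_i \text{ for } i=0,\dots,n\}$. Then $$\mathbb{P}(X_\cdot\in\mathcal{A}_\Delta)=\int \mathbf 1_{A_0}\,T_{t_1-t_0}\big(\mathbf 1_{A_1}T_{t_2-t_1}(\cdots T_{t_n-t_{n-1}}\mathbf 1_{A_n})\big)\,dm \le \sqrt{m(A_0)}\sqrt{m(A_n)}\exp\Big(-\frac12\sum_{i=0}^{n-1}\frac{d^2(A_i,A_{i+1})}{t_{i+1}-t_i}\Big),$$ where $d$ is the intrinsic metric between sets defined in the context.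
   Context: $\mathbb{D}_b=\mathbb{D}\cap L^\infty(\mathcal{X};m)$. For $f,g,h\in\mathbb{D}_b$ set $I(f,g;h)=\mathcal{E}(gh,f)+\mathcal{E}(fh,g)-\mathcal{E}(fg,h)$ and $I_f(h)=I(f,f;h)$. Let $\mathbb{D}_0=\{f\in\mathbb{D}_b : I_f(h)\le\|h\|_{L^1(m)} \text{ for all } h\in\mathbb{D}_b\}$. For measurable $A,B\subset\mathcal{X}$ the intrinsic distance is $d(A,B)=\sup_{f\in\mathbb{D}_0}\{\operatorname{ess\,inf}_{x\in B}f(x)-\operatorname{ess\,sup}_{y\in A}f(y)\}$, with conventions $\sup\emptyset=-\infty$, $\inf\emptyset=\infty$ (so $d$ may take the value $\infty$, in which case the exponential is $0$). *)

(* Defs.v *)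
From HB Require Import structures.
From mathcomp Require Import all_boot all_order all_algebra.
From mathcomp Require Import all_classical all_reals all_analysis.
Set Implicit Arguments.
Unset Strict Implicit.
Unset Printing Implicit Defensive.
Import Order.TTheory GRing.Theory Num.Theory.
Import numFieldNormedType.Exports.
Local Open Scope classical_set_scope.
Local Open Scope ring_scope.

Definition Borel (X : ptopologicalType) := g_sigma_algebraType (@open X).

Definition polish (R : realType) (X : ptopologicalType) : Prop :=
  (exists S : set X, countable S /\ closure S = setT) /\
  exists dist : X -> X -> R,
    (((forall x y, dist x y = 0 <-> x = y)) /\
     ((forall x y, dist x y = dist y x)) /\
     ((forall x y z, dist x z <= dist x y + dist y z)) /\
     ((forall U : set X, open U <->
           forall x, U x -> exists2 e : R, 0 < e & [set y | dist x y < e] `<=` U)) /\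
        ((forall u : nat -> X,
           (forall e : R, 0 < e -> exists N : nat, forall k l : nat,
              (N <= k)%N -> (N <= l)%N -> dist (u k) (u l) < e) ->
           exists x : X, u @ \oo --> x))).

Section L2.
Context (R : realType) (X : ptopologicalType) (m : probability (Borel X) R).

(* square-integrable (Borel-measurable) functions; L^2(m) is handled through
   representatives, all statements being compatible with m-a.e. equality *)
Definition L2 (f : Borel X -> R) : Prop :=
  measurable_fun setT f /\ (\int[m]_x ((f x) ^+ 2)%:E < +oo)%E.

Definition ip (f g : Borel X -> R) : R := \int[m]_x (f x * g x).

Definition aeq (f g : Borel X -> R) : Prop := \forall x \ae m, f x = g x.

Definition Linf (f : Borel X -> R) : Prop :=
  exists M : R, \forall x \ae m, `|f x| <= M.

Definition markov_semigroup (T : R -> (Borel X -> R) -> (Borel X -> R)) : Prop :=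
  (((forall t f, 0 <= t -> L2 f -> L2 (T t f))) /\
     ((forall t f g, 0 <= t -> L2 f -> L2 g -> aeq f g -> aeq (T t f) (T t g))) /\
     ((forall t a b f g, 0 <= t -> L2 f -> L2 g ->
         aeq (T t (fun x => a * f x + b * g x)) (fun x => a * T t f x + b * T t g x))) /\
     ((forall f, L2 f -> aeq (T 0 f) f)) /\
     ((forall t s f, 0 <= t -> 0 <= s -> L2 f -> aeq (T (t + s) f) (T t (T s f)))) /\
     ((forall t f g, 0 <= t -> L2 f -> L2 g -> ip (T t f) g = ip f (T t g))) /\
     ((forall t f, 0 <= t -> L2 f -> ip (T t f) (T t f) <= ip f f)) /\
     ((forall f, L2 f ->
         (fun t => ip (T t f \- f) (T t f \- f)) @ 0^'+ --> 0)) /\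
     ((forall t f, 0 <= t -> L2 f -> (\forall x \ae m, 0 <= f x <= 1) ->
         \forall x \ae m, 0 <= T t f x <= 1)) /\
     ((forall t, 0 <= t -> aeq (T t (cst 1)) (cst 1)))).

Definition dirichlet_form (E : (Borel X -> R) -> (Borel X -> R) -> R)
    (D : set (Borel X -> R)) : Prop :=
  ((D `<=` L2) /\
     ((forall a b f g, D f -> D g -> D (fun x => a * f x + b * g x))) /\
     ((forall f g, D f -> L2 g -> aeq f g -> D g /\ forall h, D h -> E g h = E f h)) /\
     ((forall f g, D f -> D g -> E f g = E g f)) /\
     ((forall a b f g h, D f -> D g -> D h ->
         E (fun x => a * f x + b * g x) h = a * E f h + b * E g h)) /\
     ((forall f, D f -> 0 <= E f f)) /\
     ((forall f, L2 f -> forall e : R, 0 < e ->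
         exists2 g, D g & ip (f \- g) (f \- g) < e)) /\
     ((forall u : nat -> Borel X -> R, (forall k, D (u k)) ->
         (forall e : R, 0 < e -> exists N : nat, forall k l : nat,
            (N <= k)%N -> (N <= l)%N ->
            E (u k \- u l) (u k \- u l) + ip (u k \- u l) (u k \- u l) < e) ->
         exists2 v, D v &
           (fun k => E (u k \- v) (u k \- v) + ip (u k \- v) (u k \- v)) @ \oo --> 0)) /\
     (      (forall f, D f ->
         D (fun x => Num.min (Num.max (f x) 0) 1) /\
         E (fun x => Num.min (Num.max (f x) 0) 1) (fun x => Num.min (Num.max (f x) 0) 1)
           <= E f f))).

Definition form_of_semigroup (T : R -> (Borel X -> R) -> (Borel X -> R))
    (E : (Borel X -> R) -> (Borel X -> R) -> R) (D : set (Borel X -> R)) : Prop :=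
  (forall f, L2 f ->
     (D f <-> exists l : R, (fun t => ip (f \- T t f) f / t) @ 0^'+ --> l)) /\
  (forall f g, D f -> D g -> (fun t => ip (f \- T t f) g / t) @ 0^'+ --> E f g).

(* locality (Bouleau--Hirsch): E(F o u, G o u) = 0 for Lipschitz F, G
   vanishing at 0 with disjoint closed supports *)
Definition local_form (E : (Borel X -> R) -> (Borel X -> R) -> R)
    (D : set (Borel X -> R)) : Prop :=
  forall (u : Borel X -> R) (F G : R -> R), D u ->
    (exists k : R, forall x y, `|F x - F y| <= k * `|x - y|) ->
    (exists k : R, forall x y, `|G x - G y| <= k * `|x - y|) ->
    F 0 = 0 -> G 0 = 0 ->
    closure [set x | F x != 0] `&` closure [set x | G x != 0] = set0 ->
    E (F \o u) (G \o u) = 0.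

Definition Db (D : set (Borel X -> R)) := [set f | D f /\ Linf f].

Definition II (E : (Borel X -> R) -> (Borel X -> R) -> R) (f g h : Borel X -> R) : R :=
  E (g \* h) f + E (f \* h) g - E (f \* g) h.

Definition D0 (E : (Borel X -> R) -> (Borel X -> R) -> R) (D : set (Borel X -> R)) :=
  [set f | Db D f /\
     forall h, Db D h -> ((II E f f h)%:E <= \int[m]_x (`|h x|)%:E)%E].

Definition esssup_on (A : set (Borel X)) (f : Borel X -> R) : \bar R :=
  ereal_inf [set y : \bar R | \forall x \ae m, A x -> ((f x)%:E <= y)%E].
Definition essinf_on (B : set (Borel X)) (f : Borel X -> R) : \bar R :=
  ereal_sup [set y : \bar R | \forall x \ae m, B x -> (y <= (f x)%:E)%E].

Definition intrinsic_dist (E : (Borel X -> R) -> (Borel X -> R) -> R)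
    (D : set (Borel X -> R)) (A B : set (Borel X)) : \bar R :=
  ereal_sup [set (essinf_on B f - esssup_on A f)%E | f in D0 E D].

Definition nestT (T : R -> (Borel X -> R) -> (Borel X -> R)) (n : nat)
    (t : nat -> R) (A : nat -> set (Borel X)) : Borel X -> R :=
  foldr (fun i g => \1_(A i) \* T (t i.+1 - t i) g) (\1_(A n)) (iota 0 n).

Definition transition_of (T : R -> (Borel X -> R) -> (Borel X -> R))
    (p : R -> R.-pker (Borel X) ~> (Borel X)) : Prop :=
  forall t (B : set (Borel X)), 0 < t -> measurable B ->
    \forall x \ae m, fine (p t x B) = T t (\1_B) x.

Definition chain (p : R -> R.-pker (Borel X) ~> (Borel X)) (n : nat)
    (s : nat -> R) (B : nat -> set (Borel X)) : Borel X -> \bar R :=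
  foldr (fun (i : nat) (g : Borel X -> \bar R) => fun x => (\int[p (s i.+1 - s i)%R x]_y ((\1_(B i.+1) y)%:E * g y))%E)
        (cst 1%E) (iota 0 n).

Definition markov_process (dO : measure_display) (Omega : measurableType dO)
    (P : probability Omega R) (Y : Omega -> R -> X)
    (p : R -> R.-pker (Borel X) ~> (Borel X)) : Prop :=
  (forall t, 0 <= t <= 1 -> measurable_fun setT (fun w => (Y w t : Borel X))) /\
  forall (n : nat) (s : nat -> R) (B : nat -> set (Borel X)),
    s 0 = 0 -> (forall i, (i < n)%N -> s i < s i.+1) -> s n <= 1 ->
    (forall i, (i <= n)%N -> measurable (B i)) ->
    P [set w | forall i, (i <= n)%N -> B i (Y w (s i))] =
      (\int[m]_x ((\1_(B 0) x)%:E * chain p n s B x))%E.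

End L2.

(* Main.v *)
(* Davies' method.  Let [Sm t] be the transition kernel acting on bounded
   measurable functions.  For t > 0 the approximating form
   E_t(f, g) = t^-1 <f - T_t f, g> is half of t^-1 times the integral of
   (f x - f y)(g x - g y) against the joint law of the process at times 0 and t;
   this turns pointwise inequalities into inequalities between forms.
   Since s |-> |T_s f|^2 is convex, E_t(f, f) decreases in t, so that f lies in the
   domain as soon as E_t(f, f) stays bounded: the domain is stable under products
   and Lipschitz maps, and contains T_s u for every s > 0.  Locality makes the
   fourth moment of the increment f x - f y negligible with respect to t.
   For f in D_0 and v = e^(b f) w, expanding
   cosh (b (f x - f y)) to second order then yields
   - 2 E(w, e^(2 b f) w) <= b^2 |v|^2, whence by Gronwall
   |e^(b f) T_s u| <= e^(b^2 s / 2) |e^(b f) u|.  Optimizing in b bounds the norm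
   of 1_A T_s 1_B by e^(- d(A, B)^2 / (2 s)); the theorem is the product of
   these operator bounds along the partition. *)
Require Import Defs.
From HB Require Import structures.
From mathcomp Require Import all_boot all_order all_algebra.
From mathcomp Require Import all_classical all_reals all_analysis.
From mathcomp Require Import measurable_realfun ring lra.
Set Implicit Arguments.
Unset Strict Implicit.
Unset Printing Implicit Defensive.
Import Order.TTheory GRing.Theory Num.Theory.
Import numFieldNormedType.Exports.
Local Open Scope classical_set_scope.
Local Open Scope ring_scope.

(** Neither an energy measure nor a chain rule is at hand: locality only says that
    [E (F \o u) (G \o u) = 0] for cutoffs with separated supports, and [D0] is an integrated
    condition. The argument therefore works with the approximating forms, where estimates are
    pointwise inequalities between increments, and passes to the limit in finite sums only. Locality
    enters at one place: increments larger than [4 * e] are caught by finitely many pairs of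
    cutoffs, whose joint integrals are o(t). The quartic remainder of the exponential expansion then
    vanishes in the limit, while its quadratic term becomes [II E f f h]. A second obstacle is that
    [T t] acts on functions known up to null sets and agrees with the kernel only almost everywhere.
    Functions bounded everywhere ([bm]) avoid it: they are stable under products and under the
    kernel, all their integrals are finite, and an essentially bounded function can be truncated to
    one of them. *)

Section bounded_measurable.
Context (R : realType) (d : measure_display) (T : measurableType d).
Implicit Types (f g : T -> R).

Definition bm f := measurable_fun setT f /\ exists M : R, forall x, `|f x| <= M.

Lemma bm_cst (c : R) : bm (fun=> c).
Proof. by split; [exact: measurable_cst|exists `|c|]. Qed.

Lemma bm_indic (A : set T) : measurable A -> bm (\1_A).
Proof.
move=> mA; split; first exact: measurable_indic.
by exists 1 => x; rewrite indicE; case: (_ \in _); rewrite ?normr1 ?normr0.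
Qed.

Lemma bmD f g : bm f -> bm g -> bm (fun x => f x + g x).
Proof.
move=> [mf [M Mf]] [mg [N Ng]]; split; first exact: measurable_funD.
by exists (M + N) => x; rewrite (le_trans (ler_normD _ _))// lerD.
Qed.

Lemma bmM f g : bm f -> bm g -> bm (fun x => f x * g x).
Proof.
move=> [mf [M Mf]] [mg [N Ng]]; split; first exact: measurable_funM.
by exists (M * N) => x; rewrite normrM ler_pM.
Qed.

Lemma bmN f : bm f -> bm (fun x => - f x).
Proof.
move=> [mf [M Mf]]; split; first exact: measurableT_comp.
by exists M => x; rewrite normrN.
Qed.

Lemma bmB f g : bm f -> bm g -> bm (fun x => f x - g x).
Proof. by move=> bf bg; apply: bmD => //; exact: bmN. Qed.

Lemma bmX f n : bm f -> bm (fun x => f x ^+ n).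
Proof.
move=> [mf [M Mf]]; split; first exact: measurable_funX.
by exists (M ^+ n) => x; rewrite normrX lerXn2r ?nnegrE// (le_trans _ (Mf x)).
Qed.

Lemma bm_norm f : bm f -> bm (fun x => `|f x|).
Proof.
move=> [mf [M Mf]]; split; first exact: measurableT_comp.
by exists M => x; rewrite normr_id.
Qed.

Lemma bm_comp (h : R -> R) f : continuous h -> bm f -> bm (fun x => h (f x)).
Proof.
move=> ch [mf [M Mf]]; split.
  by apply: measurableT_comp mf => //; exact: continuous_measurable_fun.
have [M0|M0] := leP 0 M; last first.
  by exists 0 => x; have := le_lt_trans (Mf x) M0; rewrite normr_lt0.
have cw : {within `[- M, M], continuous (fun x => `|h x|)}.
  apply: continuous_subspaceT => x.
  exact: (@continuous_comp _ _ _ h Num.norm _ (ch x) (@norm_continuous _ _ _)).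
have [c _ hc] := EVT_max (ge0_cp M0).2 cw.
by exists `|h c| => x; apply: hc; rewrite in_itv/= -ler_norml.
Qed.

Lemma bm_bounded f : bm f -> exists M : R, 0 < M /\ forall x, `|f x| <= M.
Proof.
move=> [_ [M Mf]]; exists (`|M| + 1); split; first by rewrite ltr_wpDl.
by move=> x; rewrite (le_trans (Mf x))// (le_trans (ler_norm _))// lerDl.
Qed.

(* Halving: a function with values in [0, C] is (C/2) times an indicator plus a
   function with values in [0, C/2], so finitely many indicators approximate
   it uniformly. *)
Lemma bm_ind (Q : (T -> R) -> Prop) :
  (forall A, measurable A -> Q (\1_A)) ->
  (forall a b f g, bm f -> bm g -> Q f -> Q g ->
    Q (fun x => a * f x + b * g x)) ->
  (forall f, bm f ->
    (forall e, 0 < e -> exists g, [/\ bm g, Q g & forall x, `|f x - g x| <= e]) ->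
    Q f) ->
  forall f, bm f -> Q f.
Proof.
move=> Q1 QD Qlim.
have Q0 : Q (fun=> 0).
  have b1 := bm_indic measurableT; have q1 := Q1 _ measurableT.
  have := QD 0 0 _ _ b1 b1 q1 q1.
  by congr Q; apply/funext => x; rewrite !mul0r addr0.
have step n : forall (C : R) f, 0 <= C -> measurable_fun setT f ->
    (forall x, 0 <= f x <= C) ->
    exists g, [/\ bm g, Q g & forall x, 0 <= f x - g x <= C / 2 ^+ n].
  elim: n => [|n IH] C f C0 mf fC.
    by exists (fun=> 0); split=> // [|x]; [exact: bm_cst|rewrite subr0 expr0 divr1].
  pose A := [set x | C / 2 <= f x].
  have mA : measurable A.
    rewrite -[A]setTI; apply: (measurable_fun_le measurableT) => //.
  pose f' := fun x => f x - C / 2 * \1_A x.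
  have [|||g [bg qg hg]] := IH (C / 2) f'.
  - by rewrite divr_ge0.
  - apply: measurable_funB => //; apply: measurable_funM => //.
    
  - move=> x; rewrite /f' indicE; have := fC x.
    have [xA|xA] := boolP (x \in A).
      by have := set_mem xA; rewrite /A/=; lra.
    have : ~ A x by move=> /mem_set; exact/negP.
    by rewrite /A/= => /negP; rewrite -ltNge; lra.
  exists (fun x => C / 2 * \1_A x + 1 * g x); split.
  - apply: bmD; first by apply: bmM; [exact: bm_cst|exact: bm_indic].
    by apply: bmM => //; exact: bm_cst.
  - by apply: QD => //; [exact: bm_indic|exact: Q1].
  - move=> x; have := hg x; rewrite /f' mul1r exprS invfM mulrA.
    by move=> h; rewrite opprD addrA.
have Qpos f C : bm f -> (forall x, 0 <= f x <= C) -> Q f.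
  move=> bf fC; apply: Qlim => // e e0.
  have C0 : 0 <= C by have /andP[] := fC point; exact: le_trans.
  pose n := Num.truncn (C / e).
  have Cn : C / 2 ^+ n.+1 <= e.
    rewrite ler_pdivrMr ?exprn_gt0// mulrC -ler_pdivrMr//.
    apply: (@le_trans _ _ n.+1%:R).
      by apply: ltW; exact: truncnS_gt.
    by rewrite -natrX ler_nat ltnW// ltn_expl.
  have [g [bg qg hg]] := step n.+1 C f C0 bf.1 fC.
  exists g; split => // x; have /andP[h1 h2] := hg x.
  by rewrite ger0_norm// (le_trans h2).
move=> f bf; have [M [M0 Mf]] := bm_bounded bf.
have b1 := bm_indic measurableT; have q1 := Q1 _ measurableT.
have bM : bm (fun x => f x + M) by apply: bmD => //; exact: bm_cst.
have := QD 1 (- M) _ _ bM b1 _ q1.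
have -> : (fun x => 1 * (f x + M) + - M * \1_[set: T] x) = f.
  by apply/funext => x; rewrite indicT /cst; ring.
apply; apply: (Qpos _ (M + M)) => // x.
by have := Mf x; rewrite ler_norml; lra.
Qed.

End bounded_measurable.

Arguments bm_cst {R d T} c.
#[global] Hint Resolve bm_cst : core.

(** * Real integrals of bounded functions against a measure of mass one *)

Section integral_bm.
Context (R : realType) (d : measure_display) (T : measurableType d).
Context (mu : {measure set T -> \bar R}) (mu1 : mu setT = 1%E).
Implicit Types (f g : T -> R).

Lemma bm_integrable f : bm f -> mu.-integrable setT (EFin \o f).
Proof.
move=> [mf [M Mf]]; apply: measurable_bounded_integrable => //.
  by rewrite mu1 ltry.
exists M; split; first exact: num_real.
by move=> N MN x _ /=; rewrite (le_trans (Mf x))// ltW.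
Qed.

Lemma int_cst (c : R) : \int[mu]_x c = c.
Proof. by rewrite Rintegral_cst// mu1 mulr1. Qed.

Lemma intD f g : bm f -> bm g ->
  \int[mu]_x (f x + g x) = \int[mu]_x f x + \int[mu]_x g x.
Proof. by move=> bf bg; rewrite RintegralD//; exact: bm_integrable. Qed.

Lemma intB f g : bm f -> bm g ->
  \int[mu]_x (f x - g x) = \int[mu]_x f x - \int[mu]_x g x.
Proof. by move=> bf bg; rewrite RintegralB//; exact: bm_integrable. Qed.

Lemma intZ c f : bm f -> \int[mu]_x (c * f x) = c * \int[mu]_x f x.
Proof. by move=> bf; rewrite RintegralZl//; exact: bm_integrable. Qed.

Lemma le_int f g : bm f -> bm g -> (forall x, f x <= g x) ->
  \int[mu]_x f x <= \int[mu]_x g x.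
Proof. by move=> bf bg fg; apply: le_Rintegral => //; exact: bm_integrable. Qed.

Lemma int_eq f g : f =1 g -> \int[mu]_x f x = \int[mu]_x g x.
Proof. by move=> /funext ->. Qed.

Lemma int_ae f g : measurable_fun setT f -> measurable_fun setT g ->
  (\forall x \ae mu, f x = g x) -> \int[mu]_x f x = \int[mu]_x g x.
Proof.
move=> mf mg fg; congr fine; apply: ae_eq_integral => //.
- exact/measurable_EFinP.
- exact/measurable_EFinP.
- by apply: filterS fg => x /= ->.
Qed.

Lemma le_int_ae f g : bm f -> bm g -> (\forall x \ae mu, f x <= g x) ->
  \int[mu]_x f x <= \int[mu]_x g x.
Proof.
move=> [mf bf] [mg [N gN]] fg.
rewrite (_ : \int[mu]_x g x = \int[mu]_x (Num.max (f x) (g x))).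
  apply: le_int => //; last by move=> x; rewrite le_max lexx.
  split; first exact: measurable_maxr.
  case: bf => M fM; exists (`|M| + `|N|) => x.
  rewrite maxEle; case: ifP => _.
    rewrite (le_trans (gN x))// (le_trans (ler_norm _))// lerDr//.
  rewrite (le_trans (fM x))// (le_trans (ler_norm _))// lerDl//.
apply: int_ae => //; first exact: measurable_maxr.
by apply: filterS fg => x fg; rewrite max_r.
Qed.

Lemma le_normr_int f M : bm f -> (forall x, `|f x| <= M) ->
  `|\int[mu]_x f x| <= M.
Proof.
move=> bf fM; rewrite ler_norml -{1}(int_cst (- M)) -{2}(int_cst M).
by apply/andP; split; apply: le_int => // x; have := fM x; rewrite ler_norml => /andP[].
Qed.

(** The quadratic form in [s, t] given by the integral of [(s * f - t * g) ^+ 2] is nonnegative; it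
    is evaluated at [(C, A)] when [A] is positive. *)
Lemma cauchy_schwarz_bm f g : bm f -> bm g ->
  (\int[mu]_x (f x * g x)) ^+ 2
    <= \int[mu]_x (f x ^+ 2) * \int[mu]_x (g x ^+ 2).
Proof.
move=> bf bg; set A := \int[mu]_x (f x ^+ 2); set B := \int[mu]_x (g x ^+ 2).
set C := \int[mu]_x (f x * g x).
have q s t : 0 <= s ^+ 2 * A - 2 * s * t * C + t ^+ 2 * B.
  have -> : s ^+ 2 * A - 2 * s * t * C + t ^+ 2 * B =
      \int[mu]_x ((s * f x - t * g x) ^+ 2).
    rewrite -!intZ; [|by apply: bmX|exact: bmM|by apply: bmX].
    rewrite -intB; [|by apply: bmM => //; exact: bmX|by apply: bmM => //; exact: bmM].
    rewrite -intD; [|apply: bmB; apply: bmM => //; [exact: bmX|exact: bmM]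
                    |by apply: bmM => //; exact: bmX].
    by apply: int_eq => x; ring.
  by apply: Rintegral_ge0 => x _; exact: sqr_ge0.
have A0 : 0 <= A by apply: Rintegral_ge0 => x _; exact: sqr_ge0.
have [A0'|A0'] := ltP 0 A.
  have := q C A; rewrite -(pmulr_rge0 _ A0').
  have -> : A * (C ^+ 2 * A - 2 * C * A * C + A ^+ 2 * B) = A ^+ 2 * (A * B - C ^+ 2) by ring.
  by rewrite pmulr_rge0 ?exprn_gt0// subr_ge0.
have {}A0' : A = 0 by apply/eqP; rewrite eq_le A0' A0.
(* With [A = 0] this choice gives [- (B + 2) * C ^+ 2 >= 0], hence [C = 0]. *)
have := q (B + 1) C; rewrite A0' mul0r mulr0 add0r.
have B0 : 0 <= B by apply: Rintegral_ge0 => x _; exact: sqr_ge0.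
have C2 := sqr_ge0 C.
by nra.
Qed.

End integral_bm.

(** * The semigroup realized by the transition kernel *)

Section semigroup.
Context (R : realType) (X : ptopologicalType) (m : probability (Borel X) R).
Context (T : R -> (Borel X -> R) -> (Borel X -> R)).
Context (p : R -> R.-pker (Borel X) ~> (Borel X)).
Hypotheses (semT : markov_semigroup m T) (trT : transition_of m T p).
Implicit Types (a b f g : Borel X -> R) (s t : R).

Let m1 : m setT = 1%E. Proof. exact: probability_setT. Qed.

Let p1 t x : p t x setT = 1%E. Proof. exact: prob_kernel. Qed.

(* [Sm t b] is the representative of [T_t b] given by the transition kernel; the
   kernel at time 0 is unconstrained by [transition_of], hence the case split *)
Definition Sm t b : Borel X -> R :=
  fun x => if 0 < t then \int[p t x]_y b y else b x.

Lemma S_norm_le t b (M : R) : bm b -> (forall x, `|b x| <= M) ->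
  forall x, `|Sm t b x| <= M.
Proof.
by move=> bb bM x; rewrite /Sm; case: ifP => // _; exact: (le_normr_int (p1 t x)).
Qed.

Lemma bm_S t b : bm b -> bm (Sm t b).
Proof.
move=> bb; have [M [M0 bM]] := bm_bounded bb.
split; last by exists M; exact: S_norm_le.
rewrite /Sm; case: ltP => // t0; last exact: bb.1.
have bbM : bm (fun x => b x + M) by apply: bmD.
apply: (eq_measurable_fun (fun x => \int[p t x]_y (b y + M) - M)).
  by move=> x _ /=; rewrite (intD (p1 t x))// (int_cst (p1 t x)) addrK.
apply: measurable_funB => //; apply: (@measurableT_comp _ _ _ _ _ _ fine) => //=.
apply: measurable_fun_integral_kernel => /=.
- by move=> U mU; exact: measurable_kernel.
- by move=> x; have := bM x; rewrite lee_fin ler_norml; lra.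
- by apply/measurable_EFinP; case: bbM.
Qed.

Lemma S_lin t (c1 c2 : R) a b : bm a -> bm b ->
  Sm t (fun x => c1 * a x + c2 * b x) =1 (fun x => c1 * Sm t a x + c2 * Sm t b x).
Proof.
move=> ba bb x; rewrite /Sm; case: ifP => // _.
by rewrite (intD (p1 t x)) ?(intZ (p1 t x))//; exact: bmM.
Qed.

Lemma SB t a b : bm a -> bm b -> Sm t (fun x => a x - b x) =1 (fun x => Sm t a x - Sm t b x).
Proof.
move=> ba bb x; have := @S_lin t 1 (-1) a b ba bb x; rewrite !mul1r !mulN1r => <-.
by congr (Sm t _ x); apply/funext => y; rewrite mul1r mulN1r.
Qed.

Lemma S1 t : Sm t (fun=> 1) = (fun=> 1).
Proof. by apply/funext => x; rewrite /Sm; case: ifP => // _; rewrite int_cst. Qed.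

Lemma bm_L2 f : bm f -> L2 m f.
Proof.
move=> bf; split; first exact: bf.1.
have /integrableP[_] := bm_integrable m1 (bmX 2 bf).
apply: le_lt_trans; apply: ge0_le_integral => //=.
- by move=> x _; rewrite lee_fin sqr_ge0.
- by apply/measurable_EFinP; case: (bmX 2 bf).
- by apply/measurable_EFinP; apply: measurableT_comp => //; case: (bmX 2 bf).
- by move=> x _; rewrite lee_fin ler_norm.
Qed.

(** The Markov property speaks of values in [0, 1] only: the affine map [(f + M) / (2 * M)] brings
    [f] there, and conservativity [T t 1 = 1] undoes the shift. *)
Lemma T_sup_contraction t f (M : R) : 0 <= t -> 0 < M -> bm f ->
  (forall x, `|f x| <= M) -> \forall x \ae m, `|T t f x| <= M.
Proof.
case: semT => [_ [_ [Tl [_ [_ [_ [_ [_ [T01 T1]]]]]]]]] t0 M0 bf fM.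
pose g := fun x => (2 * M)^-1 * f x + 2^-1 * cst 1 x.
have bg : bm g by apply: bmD; apply: bmM => //; exact: bm_cst.
have l1 : L2 m (cst 1) by exact/bm_L2/bm_cst.
have g01 : \forall x \ae m, 0 <= g x <= 1.
  apply: aeW => x; have := fM x; rewrite /g ler_norml /cst mulr1 => /andP[h1 h2].
  have -> : (2 * M)^-1 * f x + 2^-1 = (2 * M)^-1 * (f x + M) by field; lra.
  rewrite mulr_ge0 ?invr_ge0//=; [|lra|lra].
  by rewrite mulrC ler_pdivrMr; lra.
have := Tl t (2 * M)^-1 2^-1 f (cst 1) t0 (bm_L2 bf) l1.
apply: filterS3 (T01 t g t0 (bm_L2 bg) g01) (T1 t t0) => x h1 h2 h3.
move: h1; rewrite /g h3 h2 /cst mulr1.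
have -> : (2 * M)^-1 * T t f x + 2^-1 = (2 * M)^-1 * (T t f x + M) by field; lra.
rewrite mulrC pmulr_lge0 ?invr_gt0; [|lra].
by rewrite ler_pdivrMr ?ler_norml; lra.
Qed.

(** [transition_of] compares the two operators on indicators only. [bm_ind] extends this; its
    uniform limits need the sup-norm contraction of both operators, and taking the errors
    [n.+1%:R^-1] keeps the exceptional null sets countable in number. *)
Lemma T_S t f : 0 <= t -> bm f -> aeq m (T t f) (Sm t f).
Proof.
move=> t0; case: (semT) => [_ [_ [Tl [T0 _]]]].
have [t0'|] := ltP 0 t; last first.
  move=> t0' bf; have -> : t = 0 by lra.
  apply: filterS (T0 f (bm_L2 bf)) => x ->.
  by rewrite /Sm ltxx.
move: f; apply: bm_ind => [A mA|c1 c2 f g bf bg qf qg|f bf apx].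
- apply: filterS (trT t0' mA) => x <-.
  by rewrite /Sm t0' /Rintegral integral_indic// setIT.
- apply: filterS3 qf qg (Tl t c1 c2 f g t0 (bm_L2 bf) (bm_L2 bg)) => x h1 h2 ->.
  by rewrite S_lin// h1 h2.
- have key : forall n, \forall x \ae m, `|T t f x - Sm t f x| <= 2 * n.+1%:R^-1.
    move=> n; have e0 : 0 < n.+1%:R^-1 :> R by rewrite invr_gt0.
    have [g [bg qg fg]] := apx _ e0.
    have bfg : bm (fun x => f x - g x) by exact: bmB.
    have h2 := T_sup_contraction t0 e0 bfg fg.
    apply: filterS3 (Tl t 1 (-1) f g t0 (bm_L2 bf) (bm_L2 bg)) h2 qg => x h1 {}h2 h3.
    have h4 := S_norm_le t bfg fg x.
    rewrite SB// in h4.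
    have -> : T t f x - Sm t f x = T t (fun x => f x - g x) x + (Sm t g x - Sm t f x).
      rewrite (_ : (fun x => f x - g x) = (fun x => 1 * f x + -1 * g x)).
        by rewrite h1 h3; ring.
      by apply/funext => y; ring.
    rewrite (le_trans (ler_normD _ _))// mulr_natl mulr2n lerD//.
    by rewrite distrC.
  apply: filterS (ae_foralln key) => x h.
  apply/eqP; rewrite -subr_eq0 -normr_le0; apply/ler_addgt0Pr => e e0.
  rewrite add0r (le_trans (h (Num.truncn (2 / e))))//.
  rewrite ler_pdivrMr// mulrC -ler_pdivrMr// ltW//; exact: truncnS_gt.
Qed.

Lemma ip_S_sym t a b : 0 <= t -> bm a -> bm b -> ip m (Sm t a) b = ip m a (Sm t b).
Proof.
move=> t0 ba bb; case: (semT) => [TL [_ [_ [_ [_ [Ts _]]]]]].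
have e1 := T_S t0 ba; have e2 := T_S t0 bb.
have := Ts t a b t0 (bm_L2 ba) (bm_L2 bb).
have [mTa _] := TL t a t0 (bm_L2 ba); have [mTb _] := TL t b t0 (bm_L2 bb).
rewrite /ip (int_ae (g := fun x => Sm t a x * b x)).
- move=> ->; apply: int_ae; first exact: measurable_funM ba.1 mTb.
  + exact: measurable_funM ba.1 (bm_S t bb).1.
  + by apply: filterS e2 => x ->.
- exact: measurable_funM mTa bb.1.
- exact: measurable_funM (bm_S t ba).1 bb.1.
- by apply: filterS e1 => x ->.
Qed.

(** The kernels are not assumed to satisfy Chapman-Kolmogorov pointwise; the law is inherited from
    [T], hence only almost everywhere. *)
Lemma S_add s t b : 0 <= s -> 0 <= t -> bm b -> aeq m (Sm (s + t) b) (Sm s (Sm t b)).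
Proof.
move=> s0 t0 bb; case: (semT) => [TL [Ta [_ [_ [TD _]]]]].
have lb := bm_L2 bb.
have e1 := T_S (addr_ge0 s0 t0) bb; have e2 := T_S t0 bb.
have e3 := T_S s0 (bm_S t bb).
have e4 := Ta s _ _ s0 (TL t b t0 lb) (bm_L2 (bm_S t bb)) e2.
have e5 := TD s t b s0 t0 lb.
have e13 : \forall x \ae m, T (s + t) b x = Sm (s + t) b x /\
    T s (Sm t b) x = Sm s (Sm t b) x by apply: filterS2 e1 e3.
by apply: filterS3 e13 e4 e5 => x [<- <-] -> ->.
Qed.

Lemma S_contraction t b : 0 <= t -> bm b -> ip m (Sm t b) (Sm t b) <= ip m b b.
Proof.
move=> t0 bb; case: (semT) => [TL [_ [_ [_ [_ [_ [Tc _]]]]]]].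
apply: le_trans (Tc t b t0 (bm_L2 bb)).
have [mT _] := TL t b t0 (bm_L2 bb).
rewrite /ip (int_ae (g := fun x => T t b x * T t b x))//.
- exact: measurable_funM (bm_S t bb).1 (bm_S t bb).1.
- exact: measurable_funM.
- by apply: filterS (T_S t0 bb) => x ->.
Qed.

Lemma S_cvg0 b : bm b ->
  ip m (fun x => Sm t b x - b x) (fun x => Sm t b x - b x) @[t --> 0^'+] --> 0.
Proof.
move=> bb; case: (semT) => [TL [_ [_ [_ [_ [_ [_ [Tc _]]]]]]]].
apply: cvg_trans (Tc b (bm_L2 bb)); apply: near_eq_cvg; near=> t.
have t0 : 0 <= t by near: t; exact: nbhs_right_ge.
have [mT _] := TL t b t0 (bm_L2 bb).
have bS := bm_S t bb.
apply: int_ae.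
- apply: measurable_funM; apply: measurable_funB => //; exact: bb.1.
- apply: measurable_funM; apply: measurable_funB => //;
    [exact: bS.1|exact: bb.1|exact: bS.1|exact: bb.1].
- by apply: filterS (T_S t0 bb) => x /= ->.
Unshelve. all: by end_near. Qed.

End semigroup.

(** The function [l], [b] times the gap between [k] and its chord, vanishes at 0 and [b]. At a
    maximum point [c], reflecting the nearer endpoint through [c] stays in [0, b], so midpoint
    convexity gives [2 * l c <= 0 + l c]. *)
Lemma midpoint_convex_chord (R : realType) (k : R -> R) :
  continuous k ->
  (forall a b, 0 <= a -> 0 <= b -> 2 * k ((a + b) / 2) <= k a + k b) ->
  forall a b, 0 < a -> a < b -> b * k a <= (b - a) * k 0 + a * k b.
Proof.
move=> ck mk a b a0 ab.
have b0 : 0 < b by lra.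
pose l := fun x => b * k x - (b - x) * k 0 - x * k b.
have cl : {within `[0, b], continuous l}.
  apply: continuous_subspaceT => x; rewrite /l.
  apply: cvgB; last by apply: cvgMl; exact: cvg_id.
  apply: cvgB; first by apply: cvgMr; exact: ck.
  by apply: cvgMl; apply: cvgB; [exact: cvg_cst|exact: cvg_id].
have [c] := EVT_max (ltW b0) cl.
rewrite in_itv/= => /andP[c0 cb] lc.
suff lc0 : l c <= 0.
  have : l a <= l c by apply: lc; rewrite in_itv/=; lra.
  by rewrite /l in lc0 *; lra.
have l0 : l 0 = 0 by rewrite /l; ring.
have lb : l b = 0 by rewrite /l; ring.
have ml x y : 0 <= x -> 0 <= y -> 2 * l ((x + y) / 2) <= l x + l y.
  by move=> x0 y0; have := mk x y x0 y0; rewrite /l; nra.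
have [cb2|cb2] := leP c (b - c).
  have := ml 0 (2 * c) (lexx _).
  have -> : (0 + 2 * c) / 2 = c by field.
  have : l (2 * c) <= l c by apply: lc; rewrite in_itv/=; lra.
  by rewrite l0; lra.
have := ml (2 * c - b) b.
have -> : (2 * c - b + b) / 2 = c by field.
have : l (2 * c - b) <= l c by apply: lc; rewrite in_itv/=; lra.
by rewrite lb; lra.
Qed.

(** * Approximating forms and stability of the form domain *)

Section form_domain.
Context (R : realType) (X : ptopologicalType) (m : probability (Borel X) R).
Context (E : (Borel X -> R) -> (Borel X -> R) -> R) (D : set (Borel X -> R)).
Context (T : R -> (Borel X -> R) -> (Borel X -> R)).
Context (p : R -> R.-pker (Borel X) ~> (Borel X)).
Hypotheses (semT : markov_semigroup m T) (trT : transition_of m T p).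
Hypothesis formE : form_of_semigroup m T E D.
Implicit Types (a b f g u : Borel X -> R) (s t : R).
Local Notation S := (Sm p).
Local Notation ip := (ip m).

Let m1 : m setT = 1%E. Proof. exact: probability_setT. Qed.

Let p1 t x : p t x setT = 1%E. Proof. exact: prob_kernel. Qed.

Lemma ipC f g : ip f g = ip g f.
Proof. by apply: int_eq => x; rewrite mulrC. Qed.

Lemma ipSS s t f g : 0 <= s -> 0 <= t -> bm f -> bm g ->
  ip (S s f) (S t g) = ip f (S (s + t) g).
Proof.
move=> s0 t0 bf bg; rewrite (ip_S_sym semT trT)//; last exact: bm_S.
apply: int_ae.
- by apply: measurable_funM; [case: bf|case: (bm_S p s (bm_S p t bg))].
- by apply: measurable_funM; [case: bf|case: (bm_S p (s + t) bg)].
- by apply: filterS (S_add semT trT s0 t0 bg) => x ->.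
Qed.

Definition Et t f g : R := (ip f g - ip (S t f) g) / t.

Lemma Et_eqT t f g : 0 <= t -> bm f -> bm g -> ip (f \- T t f) g / t = Et t f g.
Proof.
move=> t0 bf bg; congr (_ / _).
have bS := bm_S p t bf.
rewrite /ip -(intB m1); [|exact: bmM|exact: bmM].
case: (semT) => [TL _]; have [mT _] := TL t f t0 (bm_L2 _ bf).
have mf := bf.1; have mg := bg.1; have mS := bS.1.
apply: int_ae.
- by apply: measurable_funM => //; exact: measurable_funB.
- by apply: measurable_funB; exact: measurable_funM.
- by apply: filterS (T_S semT trT t0 bf) => x /= ->; rewrite mulrBl.
Qed.

Lemma Et_cvg f g : bm f -> bm g -> D f -> D g -> Et t f g @[t --> 0^'+] --> E f g.
Proof.
move=> bf bg Df Dg; apply: cvg_trans (formE.2 f g Df Dg).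
apply: near_eq_cvg; by near=> t; apply: Et_eqT.
Unshelve. all: by end_near. Qed.

Lemma D_of_cvg f (l : R) : bm f -> Et t f f @[t --> 0^'+] --> l -> D f.
Proof.
move=> bf fl; apply/(formE.1 f (bm_L2 _ bf)); exists l.
apply: cvg_trans fl; apply: near_eq_cvg; near=> t; exact/esym/Et_eqT.
Unshelve. all: by end_near. Qed.

(* [jv t Q v] : the integral of [Q] for the joint law of the process at times
   0 and t is [v].  Only sums of tensors occur, so that no joint
   measurability is involved. *)
Definition jv t (Q : Borel X -> Borel X -> R) (v : R) :=
  [/\ forall x, bm (Q x), bm (fun x => \int[p t x]_y Q x y) &
      \int[m]_x \int[p t x]_y Q x y = v].

Lemma jv_eq t Q Q' v v' : jv t Q v -> (forall x y, Q x y = Q' x y) -> v = v' ->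
  jv t Q' v'.
Proof.
move=> jQ QQ' <-; suff -> : Q' = Q by [].
by apply/funext => x; apply/funext => y; rewrite QQ'.
Qed.

Lemma jvD t Q Q' v v' : jv t Q v -> jv t Q' v' ->
  jv t (fun x y => Q x y + Q' x y) (v + v').
Proof.
move=> [bQ bQ2 <-] [bQ' bQ2' <-].
have e x : \int[p t x]_y (Q x y + Q' x y) =
   \int[p t x]_y Q x y + \int[p t x]_y Q' x y by rewrite (intD (p1 t x)).
split; first by move=> x; exact: bmD.
  by rewrite (funext e); exact: bmD.
by rewrite (funext e) intD.
Qed.

Lemma jvZ t c Q v : jv t Q v -> jv t (fun x y => c * Q x y) (c * v).
Proof.
move=> [bQ bQ2 <-].
have e x : \int[p t x]_y (c * Q x y) = c * \int[p t x]_y Q x y by rewrite (intZ (p1 t x)).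
split; first by move=> x; exact: bmM.
  by rewrite (funext e); exact: bmM.
by rewrite (funext e) intZ.
Qed.

Lemma jv_le t Q Q' v v' : jv t Q v -> jv t Q' v' ->
  (forall x y, Q x y <= Q' x y) -> v <= v'.
Proof.
move=> [bQ bQ2 <-] [bQ' bQ2' <-] QQ'.
by apply: (le_int m1) => // x; apply: (le_int (p1 t x)).
Qed.

Lemma jv_tensor t a b : 0 < t -> bm a -> bm b ->
  jv t (fun x y => a x * b y) (ip a (S t b)).
Proof.
move=> t0 ba bb.
have e x : \int[p t x]_y (a x * b y) = a x * S t b x.
  by rewrite (intZ (p1 t x))// /Sm t0.
split; first by move=> x; exact: bmM.
  by rewrite (funext e); apply: bmM => //; exact: bm_S.
by rewrite (funext e).
Qed.

Lemma jv_fst t a : 0 < t -> bm a -> jv t (fun x y => a x) (\int[m]_x a x).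
Proof.
move=> t0 ba; apply: jv_eq (jv_tensor t0 ba (bm_cst 1)) _ _ => [x y|].
  by rewrite mulr1.
by rewrite S1; apply: int_eq => x; rewrite mulr1.
Qed.

(** Invariance of [m]: symmetry moves [S t] onto the constant 1, which it fixes. *)
Lemma jv_snd t a : 0 < t -> bm a -> jv t (fun x y => a y) (\int[m]_x a x).
Proof.
move=> t0 ba; apply: jv_eq (jv_tensor t0 (bm_cst 1) ba) _ _ => [x y|].
  by rewrite mul1r.
rewrite -(ip_S_sym semT trT) ?S1//; last exact: ltW.
by apply: int_eq => x; rewrite mul1r.
Qed.

Lemma jv_sum t (I : Type) (r : seq I) (Q : I -> Borel X -> Borel X -> R) (v : I -> R) :
  0 < t -> (forall i, jv t (Q i) (v i)) ->
  jv t (fun x y => \sum_(i <- r) Q i x y) (\sum_(i <- r) v i).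
Proof.
move=> t0 jQ; elim: r => [|i r IH].
  by apply: jv_eq (jv_fst t0 (bm_cst 0)) _ _ => [x y|]; rewrite ?(int_cst m1) big_nil.
by apply: jv_eq (jvD (jQ i) IH) _ _ => [x y|]; rewrite big_cons.
Qed.

Lemma jv_sqr_dist t f : 0 < t -> bm f ->
  jv t (fun x y => (f x - f y) ^+ 2) (2 * t * Et t f f).
Proof.
move=> t0 bf.
have j1 := jv_fst t0 (bmX 2 bf); have j2 := jv_snd t0 (bmX 2 bf).
have j3 := jvZ (-2) (jv_tensor t0 bf bf).
apply: jv_eq (jvD (jvD j1 j2) j3) _ _ => [x y|]; first ring.
have e : \int[m]_x (f x ^+ 2) = ip f f by apply: int_eq => x; ring.
rewrite e /Et (ipC (S t f)); field; lra.
Qed.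

(** The difference is [S s] applied to [S (s' - s) u - u], and [S s] contracts. Strong continuity at
    time 0 thus becomes uniform in time. *)
Lemma S_dist s s' u : 0 <= s -> s <= s' -> bm u ->
  \int[m]_x ((S s' u x - S s u x) ^+ 2) <=
  \int[m]_x ((S (s' - s) u x - u x) ^+ 2).
Proof.
move=> s0 ss' bu; have d0 : 0 <= s' - s by lra.
have bS := bm_S p (s' - s) bu.
have bw : bm (fun x => S (s' - s) u x - u x) by exact: bmB.
have := S_contraction semT trT s0 bw.
have e f : ip f f = \int[m]_x (f x ^+ 2) by apply: int_eq => x; ring.
rewrite !e; apply: le_trans; rewrite le_eqVlt; apply/orP; left; apply/eqP.
have -> : S s (fun x => S (s' - s) u x - u x) =
    (fun x => S s (S (s' - s) u) x - S s u x) by apply/funext => x; rewrite SB.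
have bSs' := bm_S p s' bu; have bSs := bm_S p s bu; have bSS := bm_S p s bS.
apply: int_ae.
- by case: (bmX 2 (bmB bSs' bSs)).
- by case: (bmX 2 (bmB bSS bSs)).
- have := S_add semT trT s0 d0 bu; rewrite addrC subrK.
  by apply: filterS => x ->.
Qed.

Lemma S_unif_cont u e : bm u -> 0 < e -> exists2 d : R, 0 < d & forall s s',
  `|s - s'| < d -> \int[m]_x ((S s u x - S s' u x) ^+ 2) < e.
Proof.
move=> bu e0; have := S_cvg0 semT trT bu.
move=> /cvgrPdist_lt /(_ e e0); rewrite near_withinE => -[/= d d0 hd].
exists d => //.
(* [Sm] is the identity at nonpositive times, so clipping at 0 yields continuity on the whole line,
   the form that the extreme value theorem is fed with later. *)
have Smax s : S s u = S (Num.max s 0) u.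
  apply/funext => x; rewrite /Sm; by have [s0|s0] := ltP 0 s; rewrite ?ltxx ?s0.
suff H s s' : 0 <= s -> s <= s' -> s' - s < d ->
    \int[m]_x ((S s' u x - S s u x) ^+ 2) < e.
  move=> s s' ss'; rewrite (Smax s) (Smax s').
  have sg (z : R) : 0 <= Num.max z 0 by rewrite le_max lexx orbT.
  have hm : `|Num.max s 0 - Num.max s' 0| < d.
    apply: le_lt_trans ss'.
    have h1 := ler_norm (s - s'); have h2 := ler_norm (s' - s); rewrite distrC in h2.
    by rewrite ler_norml; case: (leP s 0); case: (leP s' 0); lra.
  move: (sg s) (sg s') hm; set z := Num.max s 0; set z' := Num.max s' 0.
  move=> z0 z0'; rewrite ltr_norml => /andP[h1 h2].
  case: (leP z' z) => zz'; first by apply: H => //; lra.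
  under int_eq do rewrite -sqrrN opprB.
  by apply: H => //; lra.
move=> s0 ss' sd; apply: le_lt_trans (S_dist s0 ss' bu) _.
have [->|ns] := eqVneq s' s.
  have -> : S (s - s) u = u by apply/funext => x; rewrite /Sm subrr ltxx.
  by under int_eq do rewrite subrr expr0n/=; rewrite int_cst.
have : 0 < s' - s by rewrite subr_gt0 lt_neqAle eq_sym ns.
move=> s's; have := hd (s' - s) _ s's; rewrite /ball/= sub0r normrN gtr0_norm// => /(_ sd).
rewrite sub0r normrN ger0_norm; last by apply: Rintegral_ge0 => x _; rewrite -expr2 sqr_ge0.
by congr (_ < _); apply: int_eq => x; rewrite expr2.
Qed.

Lemma int_sqr_S_cont f u : bm f -> bm u ->
  continuous (fun s => \int[m]_x (f x * S s u x ^+ 2)).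
Proof.
move=> bf bu s0.
have [M [M0 fM]] := bm_bounded bf; have [N [N0 uN]] := bm_bounded bu.
apply/cvgrPdist_lt => e e0.
(* From [f * (v - w) * (v + w)] with [f] bounded by [M] and [v], [w] by [N]; what remains is an L^1
   distance, bounded by the L^2 distance. *)
pose C := 2 * M * N.
have C0 : 0 < C by rewrite !mulr_gt0.
have eC : 0 < (e / C) ^+ 2 by rewrite exprn_gt0// divr_gt0.
have [d d0 hd] := S_unif_cont bu eC.
near=> s.
have bS1 := bm_S p s0 bu; have bS2 := bm_S p s bu.
have hs : `|s0 - s| < d by near: s; exact: cvgr_dist_lt.
have := hd _ _ hs; set I2 := \int[m]_x _ => I2e.
have bdf := bm_norm (bmB bS1 bS2).
pose I1 := \int[m]_x `|S s0 u x - S s u x|.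
have I1e : I1 < e / C.
  have : I1 ^+ 2 <= I2.
    have := cauchy_schwarz_bm m1 bdf (bm_cst 1).
    under int_eq do rewrite mulr1.
    under [X in _ <= _ * X]int_eq do rewrite expr1n.
    rewrite int_cst// mulr1; move/le_trans; apply.
    rewrite le_eqVlt; apply/orP; left; apply/eqP; apply: int_eq => x.
    by rewrite -normrX ger0_norm// sqr_ge0.
  move=> h; have := le_lt_trans h I2e.
  by rewrite ltr_pXn2r// nnegrE; [apply: Rintegral_ge0|rewrite divr_ge0// ltW].
rewrite -(intB m1); [|by apply: bmM => //; exact: bmX|by apply: bmM => //; exact: bmX].
apply: le_lt_trans (_ : C * I1 < e); last by rewrite mulrC -ltr_pdivlMr.
have bd : bm (fun x => f x * S s0 u x ^+ 2 - f x * S s u x ^+ 2).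
  by apply: bmB; apply: bmM => //; exact: bmX.
apply: (le_trans (le_normr_Rintegral _ _)) => //; first exact: bm_integrable.
rewrite -(intZ m1)//; apply: (le_int m1); [exact: bm_norm|exact: bmM|move=> x].
have -> : f x * S s0 u x ^+ 2 - f x * S s u x ^+ 2 =
  f x * (S s0 u x + S s u x) * (S s0 u x - S s u x) by ring.
rewrite !normrM ler_wpM2r// /C (mulrC 2) -mulrA ler_pM//.
rewrite (le_trans (ler_normD _ _))// mulr_natl mulr2n.
by apply: lerD; exact: S_norm_le.
Unshelve. all: by end_near. Qed.

Definition energy u s : R := ip (S s u) (S s u).

Lemma energy_cont u : bm u -> continuous (energy u).
Proof.
move=> bu; rewrite (_ : energy u = fun s => \int[m]_x (1 * S s u x ^+ 2)).
  exact: (int_sqr_S_cont (bm_cst 1) bu).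
by apply/funext => s; apply: int_eq => x; ring.
Qed.

Lemma energy_ge0 u s : 0 <= energy u s.
Proof. by apply: Rintegral_ge0 => x _; rewrite -expr2 sqr_ge0. Qed.

Lemma energy0 u : energy u 0 = ip u u.
Proof. by congr ip; apply/funext => x; rewrite /Sm ltxx. Qed.

(** Both sides equal [ip u (S (a + b) u)]. Since [2 * ip v w <= ip v v + ip w w], this identity is
    the source of the convexity of the energy. *)
Lemma energyE u (a b : R) : bm u -> 0 <= a -> 0 <= b ->
  energy u ((a + b) / 2) = ip (S a u) (S b u).
Proof.
move=> bu a0 b0; have h0 : 0 <= (a + b) / 2 by lra.
rewrite /energy (ipSS h0 h0 bu bu) (ipSS a0 b0 bu bu).
by congr (ip _ (S _ _)); field.
Qed.

Lemma energy_chord u (a b : R) : bm u -> 0 < a -> a < b ->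
  b * energy u a <= (b - a) * energy u 0 + a * energy u b.
Proof.
move=> bu; apply: midpoint_convex_chord; first exact: energy_cont.
move=> {}a {}b a0 b0; rewrite (energyE bu a0 b0).
have ba := bm_S p a bu; have bb := bm_S p b bu.
rewrite /energy /ip -(intZ m1) -?(intD m1); [|exact: bmM|exact: bmM|exact: bmM].
apply: (le_int m1) => [||x].
- by apply: bmM => //; exact: bmM.
- by apply: bmD; exact: bmM.
- by have := sqr_ge0 (S a u x - S b u x); nra.
Qed.

(** Up to sign and a factor 2, [Et t u u] is the slope of a chord of the energy starting at 0; the
    half time appears because [ip (S t u) u] is the energy at [t / 2]. *)
Lemma Et_energy t u : 0 < t -> bm u -> Et t u u = (energy u 0 - energy u (t / 2)) / t.
Proof.
move=> t0 bu; rewrite energy0 /Et; congr ((_ - _) / _).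
have {1}-> : t = 0 + t by rewrite add0r.
rewrite -[t in RHS]add0r (energyE bu (lexx 0) (ltW t0)).
have -> : S 0 u = u by apply/funext => x; rewrite /Sm ltxx.
by rewrite add0r ipC.
Qed.

Lemma Et_ninc u t t' : bm u -> 0 < t -> t <= t' -> Et t' u u <= Et t u u.
Proof.
move=> bu t0; rewrite le_eqVlt => /predU1P[->//|tt'].
rewrite !Et_energy//; last lra.
rewrite ler_pdivrMr; last lra.
rewrite mulrAC ler_pdivlMr//.
have h1 : 0 < t / 2 by lra.
have h2 : t / 2 < t' / 2 by lra.
have := energy_chord bu h1 h2.
by move: (energy u 0) (energy u _) (energy u _) => x y z; lra.
Qed.

Lemma D_of_bounded u (C : R) : bm u -> (\forall t \near 0^'+, Et t u u <= C) -> D u.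
Proof.
move=> bu uC.
apply: (D_of_cvg bu (nonincreasing_at_right_cvgr (b := +oo%O) _ _ _)) => //.
  move=> x y; rewrite !in_itv/= !andbT => x0 y0 xy; exact: Et_ninc.
exists C => _ [t /= + <-]; rewrite in_itv/= andbT => t0.
(* The bound is known only near 0; any other [t] is compared with a smaller [t'] by monotonicity. *)
near (0 : R)^'+ => t'.
apply: (@le_trans _ _ (Et t' u u)); last by near: t'.
by apply: Et_ninc => //; near: t'; exact: nbhs_right_le.
Unshelve. all: by end_near. Qed.

(** A convex nonnegative energy decreases after time [s] at rate at most [energy u 0 / s]; the extra
    2 in the bound comes from the half time in [Et_energy]. *)
Lemma D_S s u : 0 < s -> bm u -> D (S s u).
Proof.
move=> s0 bu; apply: (@D_of_bounded _ (energy u 0 / (2 * s))); first exact: bm_S.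
near=> t; have t0 : 0 < t by near: t; exact: nbhs_right_gt.
rewrite Et_energy//; last exact: bm_S.
have e r : 0 <= r -> energy (S s u) r = energy u (s + r).
  move=> r0; rewrite addrC; have bS1 := bm_S p r (bm_S p s bu).
  have bS2 := bm_S p (r + s) bu.
  apply: int_ae; [by case: (bmM bS1 bS1)|by case: (bmM bS2 bS2)|].
  by apply: filterS (S_add semT trT r0 (ltW s0) bu) => x ->.
rewrite !e//; last lra.
rewrite addr0 ler_pdivrMr// mulrAC ler_pdivlMr; last lra.
have h : s < s + t / 2 by lra.
have := energy_chord bu s0 h; have := energy_ge0 u s.
by move: (energy u 0) (energy u _) (energy u _) => x y z; nra.
Unshelve. all: by end_near. Qed.

(** Comparing squared increments pointwise and integrating against the joint law compares the
    approximating forms. Two functions on the right are what sums and products require. *)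
Lemma D_lip2 g f1 f2 (C : R) : bm g -> bm f1 -> bm f2 -> D f1 -> D f2 -> 0 <= C ->
  (forall x y, (g x - g y) ^+ 2 <= C * ((f1 x - f1 y) ^+ 2 + (f2 x - f2 y) ^+ 2)) ->
  D g.
Proof.
move=> bg b1 b2 D1 D2 C0 H.
(* The summand 2 is slack: each [Et t] is at most its limit plus 1 for small [t]. *)
apply: (@D_of_bounded _ (C * (E f1 f1 + E f2 f2 + 2))) => //.
near=> t; have t0 : 0 < t by near: t; exact: nbhs_right_gt.
have := jv_le (jv_sqr_dist t0 bg)
  (jvZ C (jvD (jv_sqr_dist t0 b1) (jv_sqr_dist t0 b2))) H.
have -> : C * (2 * t * Et t f1 f1 + 2 * t * Et t f2 f2) =
  2 * t * (C * (Et t f1 f1 + Et t f2 f2)) by ring.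
have t2 : 0 < 2 * t by rewrite mulr_gt0.
rewrite (ler_pM2l t2) => h; apply: (le_trans h); rewrite ler_wpM2l//.
have : Et t f1 f1 <= E f1 f1 + 1.
  by near: t; apply: (cvgr_le _ (Et_cvg b1 b1 D1 D1)); rewrite ltrDl.
have : Et t f2 f2 <= E f2 f2 + 1.
  by near: t; apply: (cvgr_le _ (Et_cvg b2 b2 D2 D2)); rewrite ltrDl.
by lra.
Unshelve. all: by end_near. Qed.

Lemma D_lip g f (C : R) : bm g -> bm f -> D f ->
  (forall x y, `|g x - g y| <= C * `|f x - f y|) -> D g.
Proof.
move=> bg bf Df H; apply: (@D_lip2 g f f (C ^+ 2)) => //; first exact: sqr_ge0.
move=> x y; have := H x y; set c := g x - g y; set e := f x - f y.
move=> h; have : `|c| ^+ 2 <= (C * `|e|) ^+ 2.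
  by rewrite lerXn2r// nnegrE (le_trans _ h).
rewrite exprMn !real_normK ?num_real// => h2.
by rewrite mulrDr (le_trans h2)// lerDl mulr_ge0 ?sqr_ge0.
Qed.

Lemma D_mul f g : bm f -> bm g -> D f -> D g -> D (fun x => f x * g x).
Proof.
move=> bf bg Df Dg.
have [M [M0 fM]] := bm_bounded bf; have [N [N0 gN]] := bm_bounded bg.
apply: (@D_lip2 _ f g (2 * (N ^+ 2 + M ^+ 2))) => //; first exact: bmM.
  by have := sqr_ge0 N; have := sqr_ge0 M; lra.
move=> x y.
have sq (z B : R) : `|z| <= B -> z ^+ 2 <= B ^+ 2.
  move=> h; rewrite -(real_normK (num_real z)) lerXn2r// nnegrE (le_trans _ h)//.
have -> : f x * g x - f y * g y = (f x - f y) * g x + f y * (g x - g y) by ring.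
have h1 := sq _ _ (gN x); have h2 := sq _ _ (fM y).
set r := f x - f y; set q := g x - g y; set w := g x in h1 *; set z := f y in h2 *.
have h3 : (r * w + z * q) ^+ 2 <= 2 * ((r * w) ^+ 2 + (z * q) ^+ 2).
  by have := sqr_ge0 (r * w - z * q); nra.
apply: (le_trans h3); rewrite -mulrA ler_pM2l// !exprMn.
have r2 := sqr_ge0 r; have q2 := sqr_ge0 q; have N2 := sqr_ge0 N; have M2 := sqr_ge0 M.
by nra.
Qed.

Lemma D_cst c : D (fun=> c).
Proof.
apply: (@D_of_bounded _ 0); first exact: bm_cst.
near=> t; have t0 : 0 < t by near: t; exact: nbhs_right_gt.
have := jv_le (jv_sqr_dist t0 (bm_cst c)) (jv_fst t0 (bm_cst 0)).
rewrite (int_cst m1) => h.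
have {}h : 2 * t * Et t (fun=> c) (fun=> c) <= 0.
  by apply: h => x y; rewrite subrr expr0n.
by rewrite pmulr_rle0 in h => //; lra.
Unshelve. all: by end_near. Qed.

Lemma D_add f g : bm f -> bm g -> D f -> D g -> D (fun x => f x + g x).
Proof.
move=> bf bg Df Dg; apply: (@D_lip2 _ f g 2) => //; first exact: bmD.
by move=> x y; have := sqr_ge0 ((f x - f y) - (g x - g y)); nra.
Qed.

End form_domain.

(** * Elementary inequalities: the exponential and the cutoffs *)

Lemma ge0_of_derive (R : realType) (F G : R -> R) (Z : R) :
  (forall x, is_derive x (1 : R) F (G x)) -> F 0 = 0 ->
  (forall x, 0 <= x <= Z -> 0 <= G x) -> forall x, 0 <= x <= Z -> 0 <= F x.
Proof.
move=> dF F0 G0 x /andP[x0 xZ].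
have cF : {within `[0, x], continuous F}.
  apply: continuous_subspaceT => y.
  by apply: differentiable_continuous; apply/derivable1_diffP; case: (dF y).
have [c] := MVT_segment x0 (fun y _ => dF y) cF.
rewrite in_itv/= F0 !subr0 => /andP[c0 cx] ->.
by rewrite mulr_ge0// G0// c0 (le_trans cx).
Qed.

Lemma expRDexpRN_le (R : realType) (Z : R) : exists2 K : R, 0 <= K &
  forall z : R, `|z| <= Z -> expR z + expR (- z) <= 2 + z ^+ 2 + 2 * K * z ^+ 4.
Proof.
(* The factor 48 is 2 * 4!: the fourth derivative of [2 * K * z ^+ 4] is [48 * K], which dominates
   that of [expR z + expR (- z)] on [0, Z]. Four integrations from 0 and evenness conclude. *)
pose K := (expR Z + 1) / 48.
have e0 := expR_gt0 Z.
exists K; first by rewrite /K; lra.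
have F4 (z : R) : 0 <= z <= Z -> 0 <= 48 * K - (expR z + expR (- z)).
  move=> /andP[z0 zZ]; have : expR z <= expR Z by rewrite ler_expR.
  have : expR (- z) <= 1 by rewrite expR_le1 oppr_le0.
  by rewrite /K; lra.
have F3 (z : R) : 0 <= z <= Z -> 0 <= 48 * K * z - (expR z - expR (- z)).
  apply: (@ge0_of_derive _ (fun z => 48 * K * z - (expR z - expR (- z))) _ Z) F4 z => [x|].
    by apply: is_derive_eq; rewrite /GRing.scale/=; ring.
  by rewrite oppr0; ring.
have F2 (z : R) : 0 <= z <= Z -> 0 <= 24 * K * z ^+ 2 + 2 - (expR z + expR (- z)).
  apply: (@ge0_of_derive _ (fun z => 24 * K * z ^+ 2 + 2 - (expR z + expR (- z))) _ Z) F3 z => [x|].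
    by apply: is_derive_eq; rewrite /GRing.scale/=; ring.
  by rewrite oppr0 expR0; ring.
have F1 (z : R) : 0 <= z <= Z -> 0 <= 8 * K * z ^+ 3 + 2 * z - (expR z - expR (- z)).
  apply: (@ge0_of_derive _ (fun z => 8 * K * z ^+ 3 + 2 * z - (expR z - expR (- z))) _ Z) F2 z => [x|].
    by apply: is_derive_eq; rewrite /GRing.scale/=; ring.
  by rewrite oppr0; ring.
have F0 (z : R) : 0 <= z <= Z -> 0 <= 2 * K * z ^+ 4 + z ^+ 2 + 2 - (expR z + expR (- z)).
  apply: (@ge0_of_derive _ (fun z => 2 * K * z ^+ 4 + z ^+ 2 + 2 - (expR z + expR (- z))) _ Z) F1 z => [x|].
    by apply: is_derive_eq; rewrite /GRing.scale/=; ring.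
  by rewrite oppr0 expR0; ring.
move=> z zZ; have [z0|z0] := leP 0 z.
  by have := F0 z; rewrite z0 -(ger0_norm z0) zZ ger0_norm// => /(_ isT); lra.
have := F0 (- z); rewrite oppr_ge0 (ltW z0) -(ltr0_norm z0) zZ ltr0_norm// opprK.
have -> : (- z) ^+ 4 = z ^+ 4 by ring.
by rewrite sqrrN => /(_ isT); lra.
Qed.

Lemma expR_lip (R : realType) (M x y : R) : `|x| <= M -> `|y| <= M ->
  `|expR x - expR y| <= expR M * `|x - y|.
Proof.
wlog xy : x y / x <= y.
  move=> H xM yM; have [xy|xy] := leP x y; first exact: H.
  by rewrite distrC (distrC x); apply: H => //; exact: ltW.
move=> _ yM; rewrite ler0_norm; last by rewrite subr_le0 ler_expR.
rewrite ler0_norm ?subr_le0// !opprB.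
have h : expR y * (1 - expR (x - y)) <= expR M * (y - x).
  have := expR_ge1Dx (x - y) => h.
  have yM' : expR y <= expR M by rewrite ler_expR (le_trans (ler_norm _)).
  have e0 := expR_gt0 y.
  apply: (@le_trans _ _ (expR y * (y - x))); first by rewrite ler_pM2l//; lra.
  by rewrite ler_wpM2r// subr_ge0.
apply: le_trans h; rewrite mulrBr mulr1 -expRD.
by rewrite (_ : y + (x - y) = x)//; ring.
Qed.

Lemma continuous_of_lip1 (R : realType) (h : R -> R) :
  (forall x y, `|h x - h y| <= `|x - y|) -> continuous h.
Proof.
move=> hl x; apply/cvgrPdist_lt => e e0; near=> y.
by apply: le_lt_trans (hl x y) _; near: y; exact: cvgr_dist_lt.
Unshelve. all: by end_near. Qed.

Section cutoff.
Context (R : realType).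
Implicit Types (a e x y z : R).

(* Lipschitz functions vanishing at 0, supported below [a] and above [a + e]:
   test functions for [local_form] once [u] is shifted away from 0 *)
Definition low_cut (a z : R) : R := Num.max 0 (Num.min (a - z) z).
Definition high_cut (a e z : R) : R := Num.max 0 (z - a - e).

Lemma low_lip a x y : `|low_cut a x - low_cut a y| <= `|x - y|.
Proof.
have h1 := ler_norm (x - y); have h2 := ler_norm (y - x); rewrite distrC in h2.
rewrite ler_norml /low_cut.
by case: (leP (a - x) x); case: (leP (a - y) y) => ? ?;
  (case: (leP 0 _) => ?; case: (leP 0 _) => ?); lra.
Qed.

Lemma high_lip a e x y : `|high_cut a e x - high_cut a e y| <= `|x - y|.
Proof.
have h1 := ler_norm (x - y); have h2 := ler_norm (y - x); rewrite distrC in h2.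
rewrite ler_norml /high_cut.
by case: (leP 0 _) => ?; case: (leP 0 _) => ?; lra.
Qed.

Lemma low_high a e z : 0 < e -> low_cut a z * high_cut a e z = 0.
Proof.
move=> e0; rewrite /high_cut; case: (leP 0 _) => h; last by rewrite mulr0.
rewrite /low_cut max_l ?mul0r// ge_min; apply/orP; left; lra.
Qed.

Lemma low_ge0 a z : 0 <= low_cut a z. Proof. by rewrite le_max lexx. Qed.

Lemma high_ge0 a e z : 0 <= high_cut a e z. Proof. by rewrite le_max lexx. Qed.

(** The cut is placed at the grid point [i.+2 * e], where [i] is the integer part of [zx / e]. It
    lies more than [e] above [zx], and the gap [4 * e] leaves at least [e] above the upper
    threshold; both factors are then at least [e]. *)
Lemma low_high_separates (M : R) e zx zy : 0 < e -> e <= M -> M <= zx -> zx <= 3 * M ->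
  zx + 4 * e <= zy ->
  exists j : 'I_(Num.truncn (3 * M / e)).+4,
    e ^+ 2 <= low_cut (j%:R * e) zx * high_cut (j%:R * e) e zy.
Proof.
move=> e0 eM Mz zM zxy.
have ze0 : 0 <= zx / e by rewrite divr_ge0; lra.
have /andP[i1 i2] := truncn_itv ze0.
set i := Num.truncn (zx / e) in i1 i2.
rewrite ler_pdivlMr// in i1; rewrite ltr_pdivrMr// in i2.
have iN : (i.+2 < (Num.truncn (3 * M / e)).+4)%N.
  rewrite !ltnS (leq_trans _ (leqnSn _))//; apply: le_truncn.
  by rewrite ler_pM2r ?invr_gt0.
exists (Ordinal iN); rewrite /=.
have e2 : i.+2%:R * e = i%:R * e + 2 * e by rewrite -addn2 natrD mulrDl.
have e1 : i.+1%:R * e = i%:R * e + e by rewrite -addn1 natrD mulrDl mul1r.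
rewrite e1 in i2; rewrite e2 expr2; apply: ler_pM; [lra|lra| |].
  by rewrite /low_cut le_max; apply/orP; right; rewrite le_min; apply/andP; split; lra.
by rewrite /high_cut le_max; apply/orP; right; lra.
Qed.

End cutoff.

Lemma cvg_sum_seq (R : realType) (I : Type) (r : seq I) (F : I -> R -> R) (l : I -> R) :
  (forall i, F i t @[t --> 0^'+] --> l i) ->
  (\sum_(i <- r) F i t) @[t --> 0^'+] --> \sum_(i <- r) l i.
Proof.
move=> Fl; elim: r => [|i r IH].
  by rewrite big_nil; under eq_fun do rewrite big_nil; exact: cvg_cst.
by rewrite big_cons; under eq_fun do rewrite big_cons; exact: cvgD.
Qed.

(** * Locality and the differential inequality of Davies *)

Section davies.
Context (R : realType) (X : ptopologicalType) (m : probability (Borel X) R).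
Context (E : (Borel X -> R) -> (Borel X -> R) -> R) (D : set (Borel X -> R)).
Context (T : R -> (Borel X -> R) -> (Borel X -> R)).
Context (p : R -> R.-pker (Borel X) ~> (Borel X)).
Hypotheses (semT : markov_semigroup m T) (trT : transition_of m T p).
Hypothesis formE : form_of_semigroup m T E D.
Hypothesis locE : local_form E D.
Implicit Types (f g u w : Borel X -> R) (s t : R).
Local Notation S := (Sm p).
Local Notation ip := (ip m).
Local Notation Et := (Et m p).

Let m1 : m setT = 1%E. Proof. exact: probability_setT. Qed.

Let Et_cv f g := @Et_cvg R X m E D T p semT trT formE f g.

Lemma ipS_r t f g : ip g (S t f) = ip (S t f) g. Proof. exact: ipC. Qed.

Lemma ipS_l t f g : 0 < t -> bm f -> bm g -> ip f (S t g) = ip (S t f) g.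
Proof. by move=> t0 bf bg; rewrite (ip_S_sym semT trT)//; exact: ltW. Qed.

Lemma ip_Et t f g : 0 < t -> ip (S t f) g = ip f g - t * Et t f g.
Proof. by move=> t0; rewrite /Et; field; lra. Qed.

(** In the binomial expansion each [ip a (S t b)] equals [ip a b] minus [t] times a form. The
    zeroth-order terms all are the integral of [f ^+ 4], with coefficients 1 + 1 - 4 - 4 + 6 = 0. *)
Lemma jv_quartic t f : 0 < t -> bm f ->
  jv m p t (fun x y => (f x - f y) ^+ 4)
    (t * (8 * Et t (fun x => f x ^+ 3) f
        - 6 * Et t (fun x => f x * f x) (fun x => f x * f x))).
Proof.
move=> t0 bf; have bf4 := bmX 4 bf; have bf3 := bmX 3 bf; have bf2 := bmM bf bf.
have j1 := jv_fst m p t0 bf4; have j2 := jv_snd semT trT t0 bf4.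
have j3 := jvZ (-4) (jv_tensor m p t0 bf3 bf).
have j4 := jvZ (-4) (jv_tensor m p t0 bf bf3).
have j5 := jvZ 6 (jv_tensor m p t0 bf2 bf2).
apply: jv_eq (jvD (jvD (jvD (jvD j1 j2) j3) j4) j5) _ _ => [x y|]; first by ring.
rewrite (ipS_l t0 bf3 bf) ipS_r (ipS_l t0 bf2 bf2) !ip_Et//.
have e1 : ip (fun x => f x ^+ 3) f = \int[m]_x (f x ^+ 4) by apply: int_eq => x; ring.
have e2 : ip (fun x => f x * f x) (fun x => f x * f x) = \int[m]_x (f x ^+ 4).
  by apply: int_eq => x; ring.
by rewrite e1 e2; ring.
Qed.

(** A discrete carré du champ: the bracket is twice [II] with [Et t] in place of [E], which is why
    the weight is symmetrized as [h x + h y]. *)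
Lemma jv_gamma t f h : 0 < t -> bm f -> bm h ->
  jv m p t (fun x y => (h x + h y) * (f x - f y) ^+ 2)
    (t * (4 * Et t (fun x => f x * h x) f - 2 * Et t (fun x => f x * f x) h)).
Proof.
move=> t0 bf bh; have bf2 := bmM bf bf; have bfh := bmM bf bh.
have bhf2 := bmM bh bf2.
have j1 := jv_fst m p t0 bhf2; have j2 := jv_snd semT trT t0 bhf2.
have j3 := jvZ (-2) (jv_tensor m p t0 bfh bf).
have j4 := jvZ (-2) (jv_tensor m p t0 bf bfh).
have j5 := jv_tensor m p t0 bh bf2.
have j6 := jv_tensor m p t0 bf2 bh.
apply: jv_eq (jvD (jvD (jvD j1 j2) (jvD j3 j4)) (jvD j5 j6)) _ _ => [x y|]; first by ring.
rewrite (ipS_l t0 bfh bf) (ipS_r t _ f) (ipS_r t _ h) (ipS_l t0 bf2 bh) !ip_Et//.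
have e1 : ip (fun x => f x * h x) f = \int[m]_x (h x * (f x * f x)).
  by apply: int_eq => x; ring.
have e2 : ip (fun x => f x * f x) h = \int[m]_x (h x * (f x * f x)).
  by apply: int_eq => x; ring.
by rewrite e1 e2; ring.
Qed.

(** The gap [e] separates the closures of the supports, and [0 <= a] makes both cutoffs vanish at 0,
    as [local_form] demands. *)
Lemma E_low_high (a e : R) u : D u -> 0 <= a -> 0 < e ->
  E (low_cut a \o u) (high_cut a e \o u) = 0 /\ E (high_cut a e \o u) (low_cut a \o u) = 0.
Proof.
move=> Du a0 e0.
have l1 : exists k : R, forall x y, `|low_cut a x - low_cut a y| <= k * `|x - y|.
  by exists 1 => x y; rewrite mul1r; exact: low_lip.
have l2 : exists k : R, forall x y, `|high_cut a e x - high_cut a e y| <= k * `|x - y|.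
  by exists 1 => x y; rewrite mul1r; exact: high_lip.
have z1 : low_cut a 0 = 0 by rewrite /low_cut subr0 min_r// maxxx.
have z2 : high_cut a e 0 = 0 by rewrite /high_cut max_l//; lra.
have c1 : closure [set x | low_cut a x != 0] `<=` [set x | x <= a].
  rewrite [X in _ `<=` X]((closure_id _).1 (@closed_le _ a)).
  apply: closure_subset => x /=; apply: contra_neqT; rewrite -ltNge => ax.
  by rewrite /low_cut max_l// ge_min; apply/orP; left; lra.
have c2 : closure [set x | high_cut a e x != 0] `<=` [set x | a + e <= x].
  rewrite [X in _ `<=` X]((closure_id _).1 (@closed_ge _ (a + e))).
  apply: closure_subset => x /=; apply: contra_neqT; rewrite -ltNge => ax.
  by rewrite /high_cut max_l//; lra.
have c12 : closure [set x | low_cut a x != 0] `&` closure [set x | high_cut a e x != 0] = set0.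
  apply/seteqP; split => // x [/c1 /= x1 /c2 /= x2]; exfalso; lra.
by split; apply: locE => //; rewrite setIC.
Qed.

(** Increments at most [4 * e] contribute [16 * e ^+ 2] times their square, whose integral is
    [2 * t * Et t f f]: hence 32. Larger ones are dominated by products of separated cutoffs, whose
    forms tend to 0 by locality. *)
Lemma quartic_le f (M e : R) : bm f -> D f -> 0 < M -> (forall x, `|f x| <= M) ->
  0 < e -> e <= M ->
  8 * E (fun x => f x ^+ 3) f - 6 * E (fun x => f x * f x) (fun x => f x * f x)
    <= 32 * e ^+ 2 * E f f.
Proof.
move=> bf Df M0 fM e0 eM.
have bf3 := bmX 3 bf; have bf2 := bmM bf bf.
have Df2 := D_mul semT trT formE bf bf Df Df.
have Df3 : D (fun x => f x ^+ 3).
  have := D_mul semT trT formE bf bf2 Df Df2.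
  by congr D; apply/funext => x; ring.
(* The shift puts the values in [M, 3 * M], away from 0, where the cutoffs are forced to vanish. *)
pose u x := f x + 2 * M.
have bu : bm u by exact: bmD.
have Du : D u by apply: (D_add semT trT formE) => //; exact: (D_cst semT trT formE).
have uM x : M <= u x <= 3 * M by have := fM x; rewrite /u ler_norml; lra.
set N := (Num.truncn (3 * M / e)).+4.
pose al (j : 'I_N) : R := j%:R * e.
have al0 j : 0 <= al j by rewrite mulr_ge0// ltW.
pose F j := low_cut (al j) \o u; pose G j := high_cut (al j) e \o u.
have bF j : bm (F j).
  by apply: bm_comp bu; apply: continuous_of_lip1 => x y; exact: low_lip.
have bG j : bm (G j).
  by apply: bm_comp bu; apply: continuous_of_lip1 => x y; exact: high_lip.
have DF j : D (F j).
  by apply: (D_lip semT trT formE (C := 1) (bF j) bu Du) => x y; rewrite mul1r; exact: low_lip.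
have DG j : D (G j).
  by apply: (D_lip semT trT formE (C := 1) (bG j) bu Du) => x y; rewrite mul1r; exact: high_lip.
(* [(f x - f y) ^+ 4] is at most [(2 * M) ^+ 4], while the selected pair of cutoffs contributes at
   least [e ^+ 2]. *)
pose C := 16 * M ^+ 4 / e ^+ 2.
have C0 : 0 <= C by rewrite divr_ge0 ?mulr_ge0 ?exprn_ge0// ltW.
have e2 : 0 < e ^+ 2 by rewrite exprn_gt0.
have pw x y : (f x - f y) ^+ 4 <= 16 * e ^+ 2 * (f x - f y) ^+ 2 +
    C * \sum_(j <- index_enum 'I_N) (F j x * G j y + G j x * F j y).
  have FG0 j : 0 <= F j x * G j y + G j x * F j y.
    by apply: addr_ge0; apply: mulr_ge0; rewrite ?low_ge0 ?high_ge0.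
  have -> : (f x - f y) ^+ 4 = ((f x - f y) ^+ 2) ^+ 2 by ring.
  have d2 := sqr_ge0 (f x - f y).
  have dM : (f x - f y) ^+ 2 <= 4 * M ^+ 2.
    have := fM x; have := fM y; rewrite !ler_norml => /andP[y1 y2] /andP[x1 x2].
    have -> : 4 * M ^+ 2 = (2 * M) ^+ 2 by ring.
    by rewrite -subr_ge0 subr_sqr; apply: mulr_ge0; lra.
  have [h|h] := leP ((f x - f y) ^+ 2) (16 * e ^+ 2).
    apply: (@le_trans _ _ (16 * e ^+ 2 * (f x - f y) ^+ 2)).
      by rewrite expr2 ler_wpM2r.
    by rewrite lerDl mulr_ge0// sumr_ge0.
  apply: (@le_trans _ _ (C * e ^+ 2)).
    rewrite /C divfK ?gt_eqF//.
    have -> : 16 * M ^+ 4 = (4 * M ^+ 2) ^+ 2 by ring.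
    by rewrite lerXn2r// nnegrE//; lra.
  rewrite (@le_trans _ _ (C * \sum_(j <- index_enum 'I_N) (F j x * G j y + G j x * F j y)))//;
    last by rewrite lerDr mulr_ge0// mulr_ge0// ltW.
  rewrite ler_wpM2l//.
  suff [j hj] : exists j, e ^+ 2 <= F j x * G j y + G j x * F j y.
    apply: (le_trans hj); rewrite (bigD1 j)//= lerDl sumr_ge0//.
  have {}h : 4 * e < `|f x - f y|.
    rewrite -(@ltr_pXn2r _ 2) ?nnegrE//; last lra.
    by rewrite real_normK ?num_real//; lra.
  have /andP[ux1 ux2] := uM x; have /andP[uy1 uy2] := uM y.
  move: h; rewrite /u lter_normr => /orP[] h.
    have [|j hj] := @low_high_separates _ M e (u y) (u x) e0 eM uy1 uy2; first by rewrite /u; lra.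
    exists j; rewrite (le_trans hj)// [leLHS]mulrC lerDr mulr_ge0//;
      [exact: low_ge0|exact: high_ge0].
  have [|j hj] := @low_high_separates _ M e (u x) (u y) e0 eM ux1 ux2; first by rewrite /u; lra.
  exists j; rewrite (le_trans hj)// lerDl mulr_ge0//; [exact: high_ge0|exact: low_ge0].
(* The cutoffs have product zero, so only the term of order [t] survives. *)
have FG t j : 0 < t -> ip (F j) (S t (G j)) = - (t * Et t (G j) (F j)).
  move=> t0; rewrite ipS_r ip_Et// (_ : ip _ _ = 0) ?sub0r//.
  rewrite -[RHS](int_cst m1 0); apply: int_eq => x.
  by rewrite mulrC; exact: low_high.
have GF t j : 0 < t -> ip (G j) (S t (F j)) = - (t * Et t (F j) (G j)).
  move=> t0; rewrite ipS_r ip_Et// (_ : ip _ _ = 0) ?sub0r//.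
  rewrite -[RHS](int_cst m1 0); apply: int_eq => x.
  exact: low_high.
have key t : 0 < t ->
    8 * Et t (fun x => f x ^+ 3) f - 6 * Et t (fun x => f x * f x) (fun x => f x * f x)
    <= 32 * e ^+ 2 * Et t f f +
       C * \sum_(j <- index_enum 'I_N) (- Et t (G j) (F j) - Et t (F j) (G j)).
  move=> t0; have jq := jv_quartic t0 bf.
  have js := jvZ (16 * e ^+ 2) (jv_sqr_dist semT trT t0 bf).
  have jFG := jvZ C (jv_sum (index_enum 'I_N) t0
    (fun j => jvD (jv_tensor m p t0 (bF j) (bG j)) (jv_tensor m p t0 (bG j) (bF j)))).
  have := jv_le jq (jvD js jFG) pw.
  have -> : \sum_(j <- index_enum 'I_N) (ip (F j) (S t (G j)) + ip (G j) (S t (F j))) =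
     t * \sum_(j <- index_enum 'I_N) (- Et t (G j) (F j) - Et t (F j) (G j)).
    by rewrite big_distrr/=; apply: eq_bigr => j _; rewrite FG// GF//; ring.
  move=> h; rewrite -(ler_pM2l t0); apply: (le_trans h); rewrite le_eqVlt.
  by apply/orP; left; apply/eqP; ring.
have lim1 : (8 * Et t (fun x => f x ^+ 3) f
    - 6 * Et t (fun x => f x * f x) (fun x => f x * f x)) @[t --> 0^'+] -->
    8 * E (fun x => f x ^+ 3) f - 6 * E (fun x => f x * f x) (fun x => f x * f x).
  by apply: cvgB; apply: cvgMr; exact: Et_cv.
have lim2 : (32 * e ^+ 2 * Et t f f +
     C * \sum_(j <- index_enum 'I_N) (- Et t (G j) (F j) - Et t (F j) (G j)))
     @[t --> 0^'+] --> 32 * e ^+ 2 * E f f +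
     C * \sum_(j <- index_enum 'I_N) (- E (G j) (F j) - E (F j) (G j)).
  apply: cvgD; first by apply: cvgMr; exact: Et_cv.
  apply: cvgMr; apply: cvg_sum_seq => j; apply: cvgB; last exact: Et_cv.
  by apply: cvgN; exact: Et_cv.
have : 32 * e ^+ 2 * E f f +
     C * \sum_(j <- index_enum 'I_N) (- E (G j) (F j) - E (F j) (G j)) = 32 * e ^+ 2 * E f f.
  rewrite big1 ?mulr0 ?addr0// => j _.
  by have [-> ->] := E_low_high Du (al0 j) e0; rewrite oppr0 addr0.
move=> <-; apply: ler_cvg_to lim1 lim2 _.
by near=> t; apply: key; near: t; exact: nbhs_right_gt.
Unshelve. all: by end_near. Qed.

(* [8 E(f^3, f) - 6 E(f^2, f^2)] is the limit of [t^-1] times the fourth moment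
   of the increment of [f] over a time [t]: locality makes it vanish. *)
Lemma quartic_le0 f : bm f -> D f ->
  8 * E (fun x => f x ^+ 3) f - 6 * E (fun x => f x * f x) (fun x => f x * f x) <= 0.
Proof.
move=> bf Df; have [M [M0 fM]] := bm_bounded bf.
set Z := (X in X <= 0); have [//|Z0] := leP Z 0; exfalso.
pose B := 32 * (`|E f f| + 1).
have B0 : 0 < B by rewrite mulr_gt0// ltr_wpDl.
(* [e <= 1] lets [e ^+ 2] be replaced by [e], and the last bound makes the right-hand side at most
   [Z / 2], contradicting [0 < Z]. *)
pose e := Num.min M (Num.min 1 (Z / (2 * B))).
have e0 : 0 < e by rewrite !lt_min M0 ltr01/= divr_gt0// mulr_gt0.
have eM : e <= M by rewrite ge_min lexx.
have e1 : e <= 1 by rewrite !ge_min lexx orbT.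
have eZ : e <= Z / (2 * B) by rewrite !ge_min lexx !orbT.
have := quartic_le bf Df M0 fM e0 eM; rewrite -/Z => h.
have h2 : 32 * e ^+ 2 * E f f <= e * B.
  have -> : 32 * e ^+ 2 * E f f = e * (32 * (e * E f f)) by ring.
  rewrite ler_pM2l// /B ler_pM2l//.
  have := ler_norm (E f f); have := normr_ge0 (E f f); nra.
have h3 : e * B <= Z / 2.
  by rewrite ler_pdivlMr in eZ; [lra|rewrite mulr_gt0].
by lra.
Qed.

Lemma D_expR f (b : R) : bm f -> D f ->
  bm (fun x => expR (b * f x)) /\ D (fun x => expR (b * f x)).
Proof.
move=> bf Df; have bbf : bm (fun x => b * f x) by exact: bmM.
have be : bm (fun x => expR (b * f x)).
  by apply: (bm_comp (h := expR)) bbf; exact: continuous_expR.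
split => //; have [M [M0 fM]] := bm_bounded bbf.
apply: (D_lip semT trT formE (C := expR M * `|b|) be bf Df) => x y.
by rewrite -mulrA -normrM mulrBr; exact: expR_lip.
Qed.

(** With psi = e^(b f), v = psi w and z = b (f x - f y), the symmetrized product of [psi ^+ 2 * w]
    and [w] is [v x * v y * (expR z + expR (- z))]. Bounding [v x * v y] by the mean of the squares
    reduces everything to [h = v ^+ 2], the test function at which the condition on [f] is used. *)
Lemma davies_form f w (b : R) : bm f -> bm w -> D f -> D w ->
  (forall h, bm h -> D h -> II E f f h <= \int[m]_x `|h x|) ->
  - 2 * E w (fun x => expR (b * f x) ^+ 2 * w x) <=
    b ^+ 2 * \int[m]_x (expR (b * f x) ^+ 2 * w x ^+ 2).
Proof.
move=> bf bw Df Dw sub.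
have [bpsi Dpsi] := D_expR b bf Df.
pose psi x := expR (b * f x).
pose v x := psi x * w x.
have bv : bm v by exact: bmM.
have Dv : D v by exact: (D_mul semT trT formE).
pose h x := v x * v x.
have bh : bm h by exact: bmM.
have Dh : D h by exact: (D_mul semT trT formE).
pose q x := psi x ^+ 2 * w x.
have bq : bm q by apply: bmM => //; exact: bmX.
have Dq : D q.
  have := D_mul semT trT formE bpsi bv Dpsi Dv.
  by congr D; apply/funext => x; rewrite /q /v /psi; ring.
have bf2 := bmM bf bf; have Df2 := D_mul semT trT formE bf bf Df Df.
have bfh := bmM bf bh; have Dfh := D_mul semT trT formE bf bh Df Dh.
have bf3 := bmX 3 bf.
have Df3 : D (fun x => f x ^+ 3).
  have := D_mul semT trT formE bf bf2 Df Df2.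
  by congr D; apply/funext => x; ring.
have [M [M0 fM]] := bm_bounded bf.
have [V [V0 hV]] := bm_bounded bh.
have [K K0 hK] := expRDexpRN_le (`|b| * (2 * M)).
(* From [h x + h y <= 2 * V] and [z ^+ 4 = b ^+ 4 * (f x - f y) ^+ 4]. *)
pose C := 2 * V * K * b ^+ 4.
have C0 : 0 <= C.
  have -> : C = 2 * V * K * (b ^+ 2) ^+ 2 by rewrite /C; ring.
  by apply: mulr_ge0; [rewrite !mulr_ge0// ltW|exact: sqr_ge0].
have pw x y : q x * w y + w x * q y <= h x + h y +
    (b ^+ 2 / 2 * ((h x + h y) * (f x - f y) ^+ 2) + C * (f x - f y) ^+ 4).
  set z := b * (f x - f y).
  have zM : `|z| <= `|b| * (2 * M).
    rewrite normrM ler_wpM2l// (le_trans (ler_normB _ _))// mulr_natl mulr2n lerD//.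
  have := hK z zM.
  have zE : psi x = psi y * expR z by rewrite /psi -expRD; congr expR; rewrite /z; ring.
  have zE' : psi y = psi x * expR (- z) by rewrite /psi -expRD; congr expR; rewrite /z; ring.
  have -> : q x * w y + w x * q y = v x * v y * (expR z + expR (- z)).
    rewrite mulrDr (_ : q x * w y = v x * v y * expR z); last first.
      by rewrite /q /v expr2 {2}zE; ring.
    congr (_ + _); rewrite /q /v expr2 {2}zE'; ring.
  set c := expR z + expR (- z) => hc.
  have c0 : 0 <= c by rewrite addr_ge0// expR_ge0.
  apply: (@le_trans _ _ ((h x + h y) / 2 * c)).
    by rewrite ler_wpM2r// /h; have := sqr_ge0 (v x - v y); nra.
  have hx0 : 0 <= h x by rewrite /h -expr2 sqr_ge0.
  have hy0 : 0 <= h y by rewrite /h -expr2 sqr_ge0.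
  apply: (@le_trans _ _ ((h x + h y) / 2 * (2 + z ^+ 2 + 2 * K * z ^+ 4))).
    by rewrite ler_wpM2l// divr_ge0// addr_ge0.
  have hxV : h x <= V by rewrite (le_trans (ler_norm _)).
  have hyV : h y <= V by rewrite (le_trans (ler_norm _)).
  have z4 : 0 <= K * z ^+ 4.
    rewrite mulr_ge0//; have -> : z ^+ 4 = (z ^+ 2) ^+ 2 by ring.
    exact: sqr_ge0.
  have -> : (h x + h y) / 2 * (2 + z ^+ 2 + 2 * K * z ^+ 4) =
    h x + h y + ((h x + h y) / 2 * z ^+ 2 + (h x + h y) * (K * z ^+ 4)) by field.
  rewrite lerD2l; apply: lerD.
    by rewrite le_eqVlt; apply/orP; left; apply/eqP; rewrite /z; ring.
  apply: (@le_trans _ _ (2 * V * (K * z ^+ 4))).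
    by rewrite ler_wpM2r//; lra.
  by rewrite le_eqVlt; apply/orP; left; apply/eqP; rewrite /C /z; ring.
have key t : 0 < t -> - 2 * Et t w q <=
    b ^+ 2 / 2 * (4 * Et t (fun x => f x * h x) f - 2 * Et t (fun x => f x * f x) h)
    + C * (8 * Et t (fun x => f x ^+ 3) f
        - 6 * Et t (fun x => f x * f x) (fun x => f x * f x)).
  move=> t0.
  have jl := jvD (jv_tensor m p t0 bq bw) (jv_tensor m p t0 bw bq).
  have jr := jvD (jvD (jv_fst m p t0 bh) (jv_snd semT trT t0 bh))
    (jvD (jvZ (b ^+ 2 / 2) (jv_gamma t0 bf bh)) (jvZ C (jv_quartic t0 bf))).
  have := jv_le jl jr pw.
  rewrite (ipS_l t0 bw bq) ipS_r !ip_Et//.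
  (* The zeroth-order terms on both sides are twice the integral of [h] and cancel; dividing by [t]
     leaves forms only. *)
  have -> : ip w q = \int[m]_x h x by apply: int_eq => x; rewrite /q /h /v; ring.
  by move=> h'; rewrite -(ler_pM2l t0); lra.
have lim : - 2 * E w q <=
    b ^+ 2 / 2 * (4 * E (fun x => f x * h x) f - 2 * E (fun x => f x * f x) h)
    + C * (8 * E (fun x => f x ^+ 3) f
        - 6 * E (fun x => f x * f x) (fun x => f x * f x)).
  have lim1 : (- 2 * Et t w q) @[t --> 0^'+] --> - 2 * E w q.
    by apply: cvgMr; exact: Et_cv.
  have lim2 : (b ^+ 2 / 2 * (4 * Et t (fun x => f x * h x) f
                             - 2 * Et t (fun x => f x * f x) h)
      + C * (8 * Et t (fun x => f x ^+ 3) f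
        - 6 * Et t (fun x => f x * f x) (fun x => f x * f x))) @[t --> 0^'+] -->
      b ^+ 2 / 2 * (4 * E (fun x => f x * h x) f - 2 * E (fun x => f x * f x) h)
      + C * (8 * E (fun x => f x ^+ 3) f
        - 6 * E (fun x => f x * f x) (fun x => f x * f x)).
    by apply: cvgD; apply: cvgMr; apply: cvgB; apply: cvgMr; exact: Et_cv.
  apply: ler_cvg_to lim1 lim2 _.
  by near=> t; apply: key; near: t; exact: nbhs_right_gt.
apply: (le_trans lim).
have h0 := quartic_le0 bf Df.
have hI := sub h bh Dh.
apply: (@le_trans _ _ (b ^+ 2 * II E f f h)).
  have b2 := sqr_ge0 b.
  set A1 := E (fun x => f x * h x) f; set A2 := E (fun x => f x * f x) h.
  have -> : II E f f h = A1 + A1 - A2 by [].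
  have := mulr_ge0_le0 C0 h0.
  by move: A1 A2 => A1 A2; set A3 := C * _; lra.
rewrite ler_wpM2l ?sqr_ge0//; apply: (le_trans hI).
rewrite le_eqVlt; apply/orP; left; apply/eqP; apply: int_eq => x.
by rewrite /h ger0_norm -?expr2 ?sqr_ge0// /v /psi; ring.
Unshelve. all: by end_near. Qed.

End davies.

(* With [G s = e^(-c s) h s], a value [G b > G a] would make [G] minus a line of
   positive slope attain its minimum over [a, b] at some point s < b; there
   e^(c t) >= 1 + c t forces the right derivative of [h] above [c h]. *)
Lemma gronwall_right (R : realType) (h L : R -> R) (c : R) :
  0 <= c -> continuous h -> (forall s, 0 <= h s) ->
  (forall s, 0 < s -> ((h (s + t) - h s) / t) @[t --> 0^'+] --> L s) ->
  (forall s, 0 < s -> L s <= c * h s) ->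
  forall b, 0 < b -> h b <= expR (c * b) * h 0.
Proof.
move=> c0 ch h0 hL Lc b b0.
pose G s := expR (- c * s) * h s.
have cG : continuous G.
  move=> s; apply: cvgM; last exact: ch.
  apply: (@continuous_comp _ _ _ (fun s => - c * s) expR); last exact: continuous_expR.
  by apply: cvgMr; exact: cvg_id.
suff Gle : G b <= G 0.
  move: Gle; rewrite /G mulr0 expR0 mul1r mulNr expRN mulrC ler_pdivrMr ?expR_gt0//.
  by rewrite mulrC.
have Ga a : 0 < a -> a < b -> G b <= G a.
  move=> a0 ab; rewrite leNgt; apply/negP => Gab.
  (* Half of the mean slope still leaves [K a < K b], which keeps the minimum away from [b]. *)
  pose k := (G b - G a) / (b - a) / 2.
  have k0 : 0 < k by rewrite !divr_gt0// subr_gt0.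
  pose K s := G s - k * (s - a).
  have cK : {within `[a, b], continuous K}.
    apply: continuous_subspaceT => s; apply: cvgB; first exact: cG.
    by apply: cvgMr; apply: cvgB; [exact: cvg_id|exact: cvg_cst].
  have [s] := EVT_min (ltW ab) cK; rewrite in_itv/= => /andP[sa sb] Ks.
  have Kab : K a < K b.
    rewrite /K subrr mulr0 subr0 /k.
    have -> : (G b - G a) / (b - a) / 2 * (b - a) = (G b - G a) / 2.
      by field; lra.
    lra.
  have {}sb : s < b.
    rewrite lt_neqAle sb andbT; apply/eqP => sb'.
    have : K s <= K a by apply: Ks; rewrite in_itv/= lexx ltW.
    by rewrite sb'; lra.
  have s0 : 0 < s by lra.
  pose q := expR (c * s) * k.
  have q0 : 0 < q by rewrite mulr_gt0// expR_gt0.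
  have : c * h s + q <= L s.
    apply: (cvgr_to_ge (hL s s0)); near=> t.
    have t0 : 0 < t by near: t; exact: nbhs_right_gt.
    have tb : t <= b - s by near: t; apply: nbhs_right_le; rewrite subr_gt0.
    have : K s <= K (s + t) by apply: Ks; rewrite in_itv/=; apply/andP; split; lra.
    rewrite /K /G => Kst.
    have : h s + q * t <= expR (- (c * t)) * h (s + t).
      have e1 : expR (c * s) * expR (- c * (s + t)) = expR (- (c * t)).
        by rewrite -expRD; congr expR; ring.
      have e2 : expR (c * s) * expR (- c * s) = 1.
        by rewrite -expRD mulNr subrr expR0.
      rewrite -e1 -mulrA -[h s]mul1r -e2 -mulrA /q -mulrA -mulrDr.
      by rewrite ler_pM2l ?expR_gt0//; lra.
    move=> hst'.
    have hst : (h s + q * t) * expR (c * t) <= h (s + t).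
      by rewrite -ler_pdivlMr ?expR_gt0// (mulrC (h (s + t))) -expRN.
    rewrite ler_pdivlMr//.
    have e1 := expR_ge1Dx (c * t).
    have hs := h0 s.
    have qt : 0 < q * t by rewrite mulr_gt0.
    have ct : 0 <= c * t by rewrite mulr_ge0// ltW.
    have : (h s + q * t) * (1 + c * t) <= h (s + t).
      by apply: le_trans hst; rewrite ler_wpM2l//; lra.
    have := mulr_ge0 (ltW qt) ct.
    by lra.
  by have := Lc s s0; lra.
(* The derivative is controlled at positive times only; time 0 is reached by continuity. *)
apply: (@cvgr_to_ge _ _ _ _ G _ (G b) (cvg_at_right_filter (cG 0))).
near=> a; apply: Ga; near: a; first exact: nbhs_right_gt.
exact: nbhs_right_lt.
Unshelve. all: by end_near. Qed.

Lemma cvg_at_right_double (R : realType) (f : R -> R) (l : R) :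
  f t @[t --> 0^'+] --> l -> f (2 * t) @[t --> 0^'+] --> l.
Proof.
move=> fl A /fl [/= d d0 H]; exists (d / 2); first by rewrite /= divr_gt0.
move=> t /=; rewrite sub0r normrN => td t0; apply: H; last by rewrite mulr_gt0.
by rewrite /= sub0r normrN normrM ger0_norm// mulrC -ltr_pdivlMr.
Qed.

(** * Weighted estimates for the semigroup *)

Section davies_semigroup.
Context (R : realType) (X : ptopologicalType) (m : probability (Borel X) R).
Context (E : (Borel X -> R) -> (Borel X -> R) -> R) (D : set (Borel X -> R)).
Context (T : R -> (Borel X -> R) -> (Borel X -> R)).
Context (p : R -> R.-pker (Borel X) ~> (Borel X)).
Hypotheses (semT : markov_semigroup m T) (trT : transition_of m T p).
Hypothesis formE : form_of_semigroup m T E D.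
Hypothesis locE : local_form E D.
Implicit Types (f g u w : Borel X -> R) (s t : R) (A B : set (Borel X)).
Local Notation S := (Sm p).
Local Notation ip := (ip m).
Local Notation Et := (Et m p).

Let m1 : m setT = 1%E. Proof. exact: probability_setT. Qed.

Let Et_cv f g := @Et_cvg R X m E D T p semT trT formE f g.

(** For [w] in the domain both terms on the right tend to [2 * E w w], so the squared L^2 increment
    is o(t). *)
Lemma int_sqr_increment t w : 0 < t -> bm w ->
  \int[m]_x ((S t w x - w x) ^+ 2) / t = 2 * Et t w w - 2 * Et (2 * t) w w.
Proof.
move=> t0 bw; have bS := bm_S p t bw.
have -> : \int[m]_x ((S t w x - w x) ^+ 2) =
    ip (S t w) (S t w) - 2 * ip (S t w) w + ip w w.
  have b1 := bmM bS bS; have b2 := bmM bS bw; have b3 := bmM bw bw.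
  have b4 : bm (fun x => 2 * (S t w x * w x)) by exact: bmM.
  rewrite /ip -(intZ m1 2 b2) -(intB m1 b1 b4) -(intD m1 (bmB b1 b4) b3).
  by apply: int_eq => x; ring.
rewrite (ipSS semT trT (ltW t0) (ltW t0) bw bw) (ipC m w).
have -> : t + t = 2 * t by ring.
by rewrite /Et; field; lra.
Qed.

(** With w = S_s u, the square of S_t w is expanded around w: the linear term gives
    [- 2 * Et t w (phi * w)], and the quadratic one is negligible by [int_sqr_increment]. Positivity
    of [s] puts w in the domain. *)
Lemma int_sqr_S_right_derivative phi u s : bm phi -> bm u -> 0 < s ->
  D (fun x => phi x * S s u x) ->
  ((\int[m]_x (phi x * S (s + t) u x ^+ 2) - \int[m]_x (phi x * S s u x ^+ 2)) / t)
    @[t --> 0^'+] --> - 2 * E (S s u) (fun x => phi x * S s u x).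
Proof.
move=> bphi bu s0 Dphi.
pose w := S s u; have bw : bm w by exact: bm_S.
have Dw : D w by exact: (D_S semT trT formE).
have bpw : bm (fun x => phi x * w x) by exact: bmM.
pose rem t := \int[m]_x (phi x * (S t w x - w x) ^+ 2) / t.
have rem0 : rem t @[t --> 0^'+] --> 0.
  have [C [C0 phiC]] := bm_bounded bphi.
  have lim : (C * (2 * Et t w w - 2 * Et (2 * t) w w)) @[t --> 0^'+] --> 0.
    rewrite -[X in _ --> X](mulr0 C) -[X in _ --> C * X](subrr (2 * E w w)).
    apply: cvgMr; apply: cvgB; apply: cvgMr; first exact: Et_cv.
    exact: (cvg_at_right_double (Et_cv bw bw Dw Dw)).
  have limN : (- (C * (2 * Et t w w - 2 * Et (2 * t) w w))) @[t --> 0^'+] --> 0.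
    by rewrite -[X in _ --> X]oppr0; exact: cvgN.
  apply: (squeeze_cvgr _ limN lim); near=> t.
  have t0 : 0 < t by near: t; exact: nbhs_right_gt.
  have bd : bm (fun x => (S t w x - w x) ^+ 2).
    by apply: bmX; apply: bmB => //; exact: bm_S.
  have bpd := bmM bphi bd.
  have hr : \int[m]_x (phi x * (S t w x - w x) ^+ 2) <= C * \int[m]_x ((S t w x - w x) ^+ 2).
    rewrite -(intZ m1)//; apply: (le_int m1) => // [|x]; first exact: bmM.
    by rewrite ler_wpM2r ?sqr_ge0// (le_trans (ler_norm _)).
  have hl : - (C * \int[m]_x ((S t w x - w x) ^+ 2)) <= \int[m]_x (phi x * (S t w x - w x) ^+ 2).
    rewrite -mulNr -(intZ m1)//; apply: (le_int m1) => // [|x]; first exact: bmM.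
    by rewrite ler_wpM2r ?sqr_ge0// lerNl (le_trans (ler_norm _))// normrN.
  by rewrite -int_sqr_increment// mulrA -mulNr /rem !ler_pM2r ?invr_gt0// hl hr.
have lim : (- 2 * Et t w (fun x => phi x * w x) + rem t) @[t --> 0^'+] -->
    - 2 * E w (fun x => phi x * w x).
  rewrite -[X in _ --> X]addr0; apply: cvgD => //; apply: cvgMr; exact: Et_cv.
apply: cvg_trans lim; apply: near_eq_cvg; near=> t.
have t0 : 0 < t by near: t; exact: nbhs_right_gt.
have bSw := bm_S p t bw; have bSs := bm_S p (t + s) bu.
have -> : \int[m]_x (phi x * S (s + t) u x ^+ 2) = \int[m]_x (phi x * S t w x ^+ 2).
  rewrite addrC; apply: int_ae.
  - by case: (bmM bphi (bmX 2 bSs)).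
  - by case: (bmM bphi (bmX 2 bSw)).
  - by apply: filterS (S_add semT trT (ltW t0) (ltW s0) bu) => x ->.
have -> : \int[m]_x (phi x * S t w x ^+ 2) =
    \int[m]_x (phi x * w x ^+ 2) +
    (2 * (ip (S t w) (fun x => phi x * w x) - ip w (fun x => phi x * w x)) +
     \int[m]_x (phi x * (S t w x - w x) ^+ 2)).
  have b1 : bm (fun x => S t w x * (phi x * w x)) by exact: bmM.
  have b2 : bm (fun x => w x * (phi x * w x)) by exact: bmM.
  have b3 := bmB b1 b2.
  have b4 : bm (fun x => 2 * (S t w x * (phi x * w x) - w x * (phi x * w x))) by exact: bmM.
  have b5 : bm (fun x => phi x * (S t w x - w x) ^+ 2).
    by apply: bmM => //; apply: bmX; exact: bmB.
  have b6 : bm (fun x => phi x * w x ^+ 2) by apply: bmM => //; exact: bmX.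
  have b7 := bmD b4 b5.
  rewrite /ip -(intB m1 b1 b2) -(intZ m1 2 b3) -(intD m1 b4 b5) -(intD m1 b6 b7).
  by apply: int_eq => x; ring.
by rewrite /Et /rem; field; lra.
Unshelve. all: by end_near. Qed.

(** [D0] rephrased for functions and tests bounded everywhere, with a real-valued integral. *)
Definition subordinate f :=
  [/\ bm f, D f & forall h, bm h -> D h -> II E f f h <= \int[m]_x `|h x|].

Lemma davies f u (b s : R) : subordinate f -> bm u -> 0 < s ->
  \int[m]_x (expR (b * f x) ^+ 2 * S s u x ^+ 2) <=
  expR (b ^+ 2 * s) * \int[m]_x (expR (b * f x) ^+ 2 * u x ^+ 2).
Proof.
move=> [bf Df sub] bu s0.
have [bpsi Dpsi] := D_expR semT trT formE b bf Df.
have bphi := bmX 2 bpsi.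
have Dphi : D (fun x => expR (b * f x) ^+ 2).
  have := D_mul semT trT formE bpsi bpsi Dpsi Dpsi.
  by congr D; apply/funext => x; ring.
pose h r := \int[m]_x (expR (b * f x) ^+ 2 * S r u x ^+ 2).
have -> : \int[m]_x (expR (b * f x) ^+ 2 * u x ^+ 2) = h 0.
  by apply: int_eq => x; rewrite /Sm ltxx.
have DS r : 0 < r -> D (S r u) by move=> r0; exact: (D_S semT trT formE).
apply: (@gronwall_right _ h
  (fun r => - 2 * E (S r u) (fun x => expR (b * f x) ^+ 2 * S r u x))) => //.
- exact: sqr_ge0.
- exact: (int_sqr_S_cont semT trT bphi bu).
- by move=> r; apply: Rintegral_ge0 => x _; rewrite mulr_ge0// sqr_ge0.
- move=> r r0; apply: int_sqr_S_right_derivative => //.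
  by apply: (D_mul semT trT formE) => //; [exact: bm_S|exact: DS].
- move=> r r0; apply: (davies_form semT trT formE locE b bf _ Df _ sub); last exact: DS.
  exact: bm_S.
Qed.

Lemma S_set_bound f A B g (a b s : R) : subordinate f ->
  measurable A -> measurable B -> bm g -> 0 < s -> a <= b ->
  (\forall x \ae m, A x -> f x <= a) -> (\forall x \ae m, B x -> b <= f x) ->
  \int[m]_x ((\1_A x * S s (fun y => \1_B y * g y) x) ^+ 2) <=
  expR (- ((b - a) ^+ 2 / s)) * \int[m]_x ((\1_B x * g x) ^+ 2).
Proof.
move=> subf mA mB bg s0 ab fA fB; have [bf Df _] := subf.
have bA := @bm_indic R _ _ _ mA; have bB := @bm_indic R _ _ _ mB.
pose u x := \1_B x * g x; have bu : bm u by exact: bmM.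
(* This minimizes [be ^+ 2 * s + 2 * be * (b - a)], with minimum [- (b - a) ^+ 2 / s]. The exponent
   is nonpositive because [f] is small on [A] and large on [B]. *)
pose be := - ((b - a) / s).
have be0 : be <= 0 by rewrite oppr_le0 divr_ge0 ?subr_ge0// ltW.
have [bpsi _] := D_expR semT trT formE be bf Df.
have bphi := bmX 2 bpsi.
have bS := bm_S p s bu.
pose I1 := \int[m]_x (expR (be * f x) ^+ 2 * S s u x ^+ 2).
pose I0 := \int[m]_x (expR (be * f x) ^+ 2 * u x ^+ 2).
have bI1 : bm (fun x => expR (be * f x) ^+ 2 * S s u x ^+ 2) by apply: bmM => //; exact: bmX.
have bI0 : bm (fun x => expR (be * f x) ^+ 2 * u x ^+ 2) by apply: bmM => //; exact: bmX.
have bu2 := bmX 2 bu.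
have h1 : \int[m]_x ((\1_A x * S s u x) ^+ 2) <= expR (- (be * a)) ^+ 2 * I1.
  rewrite /I1 -(intZ m1)//; apply: (le_int_ae m1).
  - by apply: bmX; exact: bmM.
  - exact: bmM.
  - apply: filterS fA => x fa; rewrite indicE.
    have [xA|_] := boolP (x \in A); last first.
      by rewrite mul0r expr0n/=; do 2 (apply: mulr_ge0; first exact: sqr_ge0); exact: sqr_ge0.
    rewrite mul1r mulrA -exprMn -expRD ler_peMl ?sqr_ge0// -expRM_natl.
    rewrite -[leLHS]expR0 ler_expR mulr_ge0//.
    have := fa (set_mem xA); nra.
have h0 : I0 <= expR (be * b) ^+ 2 * \int[m]_x (u x ^+ 2).
  rewrite /I0 -(intZ m1)//; apply: (le_int_ae m1) => //; first exact: bmM.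
  apply: filterS fB => x fb; rewrite /u indicE.
  have [xB|_] := boolP (x \in B); last by rewrite mul0r expr0n/= !mulr0.
  rewrite mul1r ler_wpM2r ?sqr_ge0// lerXn2r ?nnegrE ?expR_ge0//.
  by rewrite ler_expR; have := fb (set_mem xB); nra.
have h01 := davies be subf bu s0.
apply: (le_trans h1).
have e2 : expR (- (be * a)) ^+ 2 * (expR (be ^+ 2 * s) * expR (be * b) ^+ 2) =
    expR (- ((b - a) ^+ 2 / s)).
  rewrite -!expRM_natl -!expRD; congr expR; rewrite /be; field; lra.
rewrite -e2 -mulrA ler_wpM2l ?sqr_ge0//.
by apply: (le_trans h01); rewrite -mulrA ler_wpM2l ?expR_ge0.
Qed.

End davies_semigroup.

(** Essential bounds may be infinite, for instance on null sets. The ambiguous differences evaluate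
    to [-oo] and are excluded by the strict inequality. *)
Lemma lt_sube_fin (R : realType) (r : R) (x y : \bar R) : (r%:E < x - y)%E ->
  exists a b : R, [/\ r < b - a, (b%:E < x)%E & (y < a%:E)%E].
Proof.
case: x y => [x| |] [y| |] //=; rewrite ?lte_fin => h.
- exists (y + (x - y - r) / 4), (x - (x - y - r) / 4).
  by split; rewrite ?lte_fin; lra.
- exists (x - 2 - r), (x - 1); split; rewrite ?lte_fin ?ltNyr//; lra.
- exists (y + 1), (y + r + 2); split; rewrite ?lte_fin ?ltry//; lra.
- exists 0, (r + 1); split; rewrite ?lte_fin ?ltry ?ltNyr//; lra.
Qed.

(** * From functions in [D0] to the intrinsic distance *)

Section set_distance.
Context (R : realType) (X : ptopologicalType) (m : probability (Borel X) R).
Context (E : (Borel X -> R) -> (Borel X -> R) -> R) (D : set (Borel X -> R)).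
Context (T : R -> (Borel X -> R) -> (Borel X -> R)).
Context (p : R -> R.-pker (Borel X) ~> (Borel X)).
Hypothesis dirE : dirichlet_form m E D.
Hypotheses (semT : markov_semigroup m T) (trT : transition_of m T p).
Hypothesis formE : form_of_semigroup m T E D.
Hypothesis locE : local_form E D.
Implicit Types (f g u w : Borel X -> R) (s : R) (A B : set (Borel X)).
Local Notation S := (Sm p).
Local Notation dist := (intrinsic_dist m E D).

Let m1 : m setT = 1%E. Proof. exact: probability_setT. Qed.

Lemma aeq_L2 f g : L2 m f -> measurable_fun setT g -> aeq m f g -> L2 m g.
Proof.
move=> [mf f2] mg fg; split => //; rewrite (_ : (\int[m]_x _ = \int[m]_x ((f x) ^+ 2)%:E)%E)//.
apply: ae_eq_integral => //.
- by apply/measurable_EFinP; exact: measurable_funX.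
- by apply/measurable_EFinP; exact: measurable_funX.
- by apply: filterS fg => x /= ->.
Qed.

Lemma bm_Db h : bm h -> D h -> Db m D h.
Proof. by move=> [_ [M hM]] Dh; split => //; exists M; exact: aeW. Qed.

(** Truncation just above the essential bound changes [f] on a null set only, and the form, hence
    [II], does not see null sets. *)
Lemma D0_subordinate f : D0 m E D f ->
  exists2 f', subordinate m E D f' & aeq m f f'.
Proof.
case: dirE => [DL2 [_ [Dae [Esym _]]]].
move=> [[Df [M fM]] sub].
have [mf _] := DL2 f Df.
pose N := `|M| + 1.
have N0 : 0 < N by rewrite ltr_wpDl.
pose f' x := Num.max (- N) (Num.min (f x) N).
have bf' : bm f'.
  split.
    by apply: measurable_maxr => //; apply: measurable_minr.
  exists N => x; rewrite ler_norml /f' le_max lexx/=.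
  by rewrite ge_max ge_min lexx orbT andbT; lra.
have ff' : aeq m f f'.
  apply: filterS fM => x fx; rewrite /f'.
  have : `|f x| <= N by rewrite (le_trans fx)// (le_trans (ler_norm _))// lerDl.
  by rewrite ler_norml => /andP[h1 h2]; rewrite min_l// max_r.
have [Df' Ef'] := Dae f f' Df (bm_L2 m bf') ff'.
exists f' => //; split => // h bh Dh.
have := sub h (bm_Db bh Dh).
have bfh := bmM bf' bh; have Dfh := D_mul semT trT formE bf' bh Df' Dh.
have bff := bmM bf' bf'; have Dff := D_mul semT trT formE bf' bf' Df' Df'.
have afh : aeq m (fun x => f' x * h x) (f \* h) by apply: filterS ff' => x /= ->.
have aff : aeq m (fun x => f' x * f' x) (f \* f) by apply: filterS ff' => x /= ->.
have lfh := aeq_L2 (bm_L2 m bfh) (measurable_funM mf bh.1) afh.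
have lff := aeq_L2 (bm_L2 m bff) (measurable_funM mf mf) aff.
have [Dfh' e1] := Dae _ _ Dfh lfh afh.
have [Dff' e2] := Dae _ _ Dff lff aff.
have -> : II E f f h = II E f' f' h.
  have e3 : E (f \* h) f = E (f' \* h) f'.
    by rewrite e1// (Esym _ f)// -Ef'// Esym.
  by rewrite /II e3 e2.
rewrite /Rintegral -lee_fin fineK//.
exact: integrable_fin_num (bm_integrable m1 (bm_norm bh)).
Qed.

Lemma D0_cst0 : D0 m E D (fun=> 0).
Proof.
case: dirE => [_ [_ [_ [_ [Elin _]]]]].
have D0' := D_cst semT trT formE 0.
split; first exact: bm_Db.
move=> h [Dh _].
have E0 k : D k -> E (fun=> 0) k = 0.
  by move=> Dk; have := Elin 0 0 _ _ k D0' D0' Dk; rewrite !mul0r !addr0.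
have e1 : ((fun=> 0) \* h) = (fun=> 0) :> (Borel X -> R).
  by apply/funext => x /=; rewrite mul0r.
have e2 : ((fun=> 0) \* (fun=> 0)) = (fun=> 0) :> (Borel X -> R).
  by apply/funext => x /=; rewrite mul0r.
rewrite /II e1 e2 !E0// addr0 subr0.
by apply: integral_ge0 => x _; rewrite lee_fin.
Qed.

(** The zero function competes in the supremum. Nonnegativity allows squaring to be monotone and the
    extended sums to be well defined. *)
Lemma intrinsic_dist_ge0 A B : (0 <= dist A B)%E.
Proof.
apply: le_trans (ereal_sup_ubound _); last by exists (fun=> 0); [exact: D0_cst0|].
rewrite -[X in (X <= _)%E](sube0 0) leeB//.
- by apply: ereal_sup_ubound => /=; apply: aeW.
- by apply: ereal_inf_lbound => /=; apply: aeW.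
Qed.

(** Covers distance 0, where no [r] with [0 <= r < dist A B] exists. *)
Lemma S_set_contraction A B g s : measurable A -> measurable B -> bm g -> 0 < s ->
  \int[m]_x ((\1_A x * S s (fun y => \1_B y * g y) x) ^+ 2) <=
  \int[m]_x ((\1_B x * g x) ^+ 2).
Proof.
move=> mA mB bg s0.
have bA := @bm_indic R _ _ _ mA; have bB := @bm_indic R _ _ _ mB.
have bu := bmM bB bg; have bS := bm_S p s bu.
have e f : ip m f f = \int[m]_x (f x ^+ 2) by apply: int_eq => x; rewrite expr2.
have := S_contraction semT trT (ltW s0) bu; rewrite !e; apply: le_trans.
apply: (le_int m1); [by apply: bmX; exact: bmM|exact: bmX|move=> x].
rewrite indicE; case: (x \in A); first by rewrite mul1r.
by rewrite mul0r expr0n sqr_ge0.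
Qed.

Lemma S_dist_bound A B g s : measurable A -> measurable B -> bm g -> 0 < s ->
  ((\int[m]_x ((\1_A x * S s (fun y => \1_B y * g y) x) ^+ 2))%:E <=
  expeR (- (dist A B * dist A B * (s^-1)%:E)) *
  (\int[m]_x ((\1_B x * g x) ^+ 2))%:E)%E.
Proof.
move=> mA mB bg s0.
have cont := S_set_contraction mA mB bg s0.
have fin r : 0 <= r -> (r%:E < dist A B)%E ->
    \int[m]_x ((\1_A x * S s (fun y => \1_B y * g y) x) ^+ 2) <=
    expR (- (r ^+ 2 / s)) * \int[m]_x ((\1_B x * g x) ^+ 2).
  move=> r0 /ereal_sup_gt[_ [f fD0 <-]] /lt_sube_fin[a [b [rab]]].
  move=> /ereal_sup_gt[y /= yB by_] /ereal_inf_lt[z /= zA za].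
  have [f' subf' ff'] := D0_subordinate fD0.
  apply: (@le_trans _ _ (expR (- ((b - a) ^+ 2 / s)) * \int[m]_x ((\1_B x * g x) ^+ 2))).
    apply: (S_set_bound semT trT formE locE subf') => //; first lra.
    - apply: filterS2 ff' zA => x <- h /h fz.
      by rewrite -lee_fin (le_trans fz)// ltW.
    - apply: filterS2 ff' yB => x <- h /h fy.
      by rewrite -lee_fin (le_trans _ fy)// ltW.
  apply: ler_wpM2r; first by apply: Rintegral_ge0 => x _; exact: sqr_ge0.
  rewrite ler_expR lerN2 ler_pM2r ?invr_gt0// lerXn2r ?nnegrE//; lra.
move: cont fin; set I1 := \int[m]_x _; set I2 := \int[m]_x _ => cont fin.
have I10 : 0 <= I1 by apply: Rintegral_ge0 => x _; exact: sqr_ge0.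
have := intrinsic_dist_ge0 A B; case: (dist A B) fin => [r| |] fin //=.
- rewrite lee_fin le_eqVlt => /predU1P[<-|r0].
    by rewrite mulr0 mul0r oppr0 expR0 mul1e lee_fin.
  rewrite lee_fin -expr2.
  (* The supremum need not be attained, so the bound at the distance itself is a limit from the
     left. *)
  have cv : (expR (- (x ^+ 2 / s)) * I2) @[x --> r^'-] --> expR (- (r ^+ 2 / s)) * I2.
    apply: cvg_at_left_filter; apply: cvgMl.
    apply: (@continuous_comp _ _ _ (fun x : R => - (x ^+ 2 / s)) expR); last exact: continuous_expR.
    by apply: cvgN; apply: cvgMl; exact: exprn_continuous.
  apply: (cvgr_to_ge cv); near=> x; apply: fin; first by near: x; exact: nbhs_left_ge.
  by rewrite lte_fin; near: x; exact: nbhs_left_lt.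
- move=> _; rewrite mulyy gt0_mulye ?lte_fin ?invr_gt0//= mul0e lee_fin.
  rewrite leNgt; apply/negP => I1p.
  have I20 : 0 <= I2 by exact: le_trans cont.
  (* At infinite distance every [r] is allowed. With [r = s * N + 1] one has [r ^+ 2 / s >= N], and
     [1 + q <= expR q] makes the bound on [I1] fail. *)
  pose N := I2 / I1 + 1; have N0 : 0 < N by rewrite ltr_wpDl// divr_ge0.
  have sN : 0 < s * N by rewrite mulr_gt0.
  have sN1 : 0 <= s * N + 1 by lra.
  have := fin _ sN1 (ltry _).
  set q := (s * N + 1) ^+ 2 / s.
  have qN : N <= q by rewrite /q ler_pdivlMr//; nra.
  have e1 := expR_ge1Dx q.
  rewrite expRN mulrC ler_pdivlMr ?expR_gt0//.
  apply/negP; rewrite -ltNge; apply: (@lt_le_trans _ _ (I1 * (1 + N))).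
    by rewrite /N addrA mulrDr mulrDr mulrCA divff ?gt_eqF//; lra.
  by rewrite ler_pM2l//; lra.
Unshelve. all: by end_near. Qed.

End set_distance.

(** * Iteration along the partition *)

Section path_bound.
Context (R : realType) (X : ptopologicalType) (m : probability (Borel X) R).
Context (E : (Borel X -> R) -> (Borel X -> R) -> R) (D : set (Borel X -> R)).
Context (T : R -> (Borel X -> R) -> (Borel X -> R)).
Context (p : R -> R.-pker (Borel X) ~> (Borel X)).
Hypothesis dirE : dirichlet_form m E D.
Hypotheses (semT : markov_semigroup m T) (trT : transition_of m T p).
Hypothesis formE : form_of_semigroup m T E D.
Hypothesis locE : local_form E D.
Context (n : nat) (t : nat -> R) (A : nat -> set (Borel X)).
Hypothesis t_lt : forall i, (i < n)%N -> t i < t i.+1.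
Hypothesis mA : forall i, (i <= n)%N -> measurable (A i).
Local Notation S := (Sm p).
Local Notation dist := (intrinsic_dist m E D).

Let m1 : m setT = 1%E. Proof. exact: probability_setT. Qed.

(** Common representative of [chain] (equal pointwise) and [nestT] (almost everywhere). The
    indicator of [A k] is left out, and the start [k] is free so that inductions peel off the
    earliest time. *)
Definition chainS k l : Borel X -> R :=
  foldr (fun i g => S (t i.+1 - t i) (fun y => \1_(A i.+1) y * g y)) (fun=> 1) (iota k l).

Definition path_action (i : nat) : \bar R :=
  (dist (A i) (A i.+1) * dist (A i) (A i.+1) * ((t i.+1 - t i)^-1)%R%:E)%E.

Lemma path_action_ge0 i : (i < n)%N -> (0 <= path_action i)%E.
Proof.
move=> /t_lt ti; have d0 := intrinsic_dist_ge0 dirE semT trT formE (A i) (A i.+1).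
by rewrite mule_ge0 ?mule_ge0// lee_fin invr_ge0 subr_ge0 ltW.
Qed.

Lemma bm_chainS l k : (k + l = n)%N -> bm (chainS k l).
Proof.
elim: l k => [|l IH] k kl; first exact: bm_cst.
apply: bm_S; apply: bmM; last by apply: IH; rewrite addSnnS.
by apply: bm_indic; apply: mA; rewrite -kl -addSnnS leq_addr.
Qed.

Lemma chainE l k : (k + l = n)%N ->
  foldr (fun (i : nat) (g : Borel X -> \bar R) => fun x =>
    (\int[p (t i.+1 - t i)%R x]_y ((\1_(A i.+1) y)%:E * g y))%E) (cst 1%E) (iota k l) =
  EFin \o chainS k l.
Proof.
elim: l k => [|l IH] k kl; first by apply/funext.
have kl' : (k.+1 + l = n)%N by rewrite addSnnS.
have kn : (k < n)%N by rewrite -kl' addSn ltnS leq_addr.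
apply/funext => x /=; rewrite (IH _ kl') /chainS/= -/(chainS k.+1 l) /Sm subr_gt0 t_lt//.
rewrite /Rintegral fineK//.
have bi : bm (fun y => \1_(A k.+1) y * chainS k.+1 l y).
  by apply: bmM; [apply: bm_indic; exact: mA|exact: bm_chainS].
exact: (integrable_fin_num measurableT (bm_integrable (prob_kernel x) bi)).
Qed.

Lemma L2_indicM (B : set (Borel X)) g : measurable B -> L2 m g -> L2 m (\1_B \* g).
Proof.
move=> mB [mg g2]; split.
  by apply: measurable_funM => //; exact: measurable_indic.
apply: le_lt_trans g2; apply: ge0_le_integral => //=.
- by move=> x _; rewrite lee_fin sqr_ge0.
- apply/measurable_EFinP; apply: measurable_funX; apply: measurable_funM => //.
- by apply/measurable_EFinP; exact: measurable_funX.
- move=> x _; rewrite lee_fin indicE; case: (x \in B); first by rewrite mul1r.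
  by rewrite mul0r expr0n sqr_ge0.
Qed.

(** Both claims go through the induction together: [T] respects almost everywhere equality only
    between L^2 functions. *)
Lemma nestS l k : (k + l = n)%N ->
  let nest := foldr (fun i g => \1_(A i) \* T (t i.+1 - t i) g) (\1_(A n)) (iota k l) in
  L2 m nest /\ aeq m (fun x => \1_(A k) x * chainS k l x) nest.
Proof.
elim: l k => [|l IH] k kl.
  rewrite /= -kl addn0; split.
    by apply: bm_L2; apply: bm_indic; apply: mA; rewrite -kl leq_addr.
  by apply: aeW => x; rewrite /chainS/= mulr1.
have kl' : (k.+1 + l = n)%N by rewrite addSnnS.
have kn : (k < n)%N by rewrite -kl' addSn ltnS leq_addr.
have dt : 0 <= t k.+1 - t k by rewrite subr_ge0 ltW// t_lt.
have [L2n ae] := IH _ kl'; case: (semT) => [TL [Tae _]].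
have bi : bm (fun y => \1_(A k.+1) y * chainS k.+1 l y).
  by apply: bmM; [apply: bm_indic; exact: mA|exact: bm_chainS].
split; first by apply: L2_indicM; [apply: mA; exact: ltnW|exact: TL].
have e1 := T_S semT trT dt bi.
have e2 := Tae _ _ _ dt (bm_L2 m bi) L2n ae.
by apply: filterS2 e1 e2 => x h1 h2 /=; rewrite -h2 h1.
Qed.

Lemma chainS_bound l k : (k + l = n)%N ->
  ((\int[m]_x ((\1_(A k) x * chainS k l x) ^+ 2))%:E <=
  expeR (- \sum_(i <- iota k l) path_action i) * m (A n))%E.
Proof.
elim: l k => [|l IH] k kl.
  rewrite big_nil oppe0 expeR0 mul1e.
  have kn : k = n by rewrite -kl addn0.
  have e x : (\1_(A k) x * chainS k 0 x) ^+ 2 = \1_(A n) x :> R.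
    by rewrite /chainS/= mulr1 kn indicE; case: (_ \in _); rewrite ?expr1n ?expr0n.
  rewrite (int_eq _ e) /Rintegral integral_indic ?setIT; [|exact: measurableT|exact: mA].
  by rewrite fineK//; apply: fin_num_measure; exact: mA.
have kl' : (k.+1 + l = n)%N by rewrite addSnnS.
have kn : (k < n)%N by rewrite -kl' addSn ltnS leq_addr.
have dt : 0 < t k.+1 - t k by rewrite subr_gt0 t_lt.
have := S_dist_bound dirE semT trT formE locE (mA (ltnW kn)) (mA kn) (bm_chainS kl') dt.
(* Distributing the opposite over the extended sum is legitimate since the terms are nonnegative. *)
move/le_trans; apply; rewrite /= big_cons oppeD; last first.
  apply: ge0_adde_def; rewrite inE ?path_action_ge0//.
  rewrite big_seq sume_ge0// => i; rewrite mem_iota => /andP[_ i2].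
  by apply: path_action_ge0; rewrite -kl'.
rewrite expeRD -[leRHS]muleA; apply: lee_wpmul2l; first exact: expeR_ge0.
exact: IH.
Qed.

End path_bound.

Theorem theorem3p1 (R : realType) (X : ptopologicalType)
    (m : probability (Borel X) R)
    (E : (Borel X -> R) -> (Borel X -> R) -> R) (D : set (Borel X -> R))
    (T : R -> (Borel X -> R) -> (Borel X -> R))
    (p : R -> R.-pker (Borel X) ~> (Borel X))
    (dO : measure_display) (Omega : measurableType dO)
    (P : probability Omega R) (Y : Omega -> R -> X)
    (n : nat) (t : nat -> R) (A : nat -> set (Borel X)) :
  polish R X ->
  dirichlet_form m E D -> local_form E D ->
  markov_semigroup m T -> form_of_semigroup m T E D ->
  transition_of m T p -> markov_process m P Y p ->
  (forall w, {within `[0, 1], continuous (Y w)}) ->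
  t 0 = 0 -> (forall i, (i < n)%N -> t i < t i.+1) -> t n = 1 ->
  (forall i, (i <= n)%N -> measurable (A i)) ->
  let event := [set w | forall i, (i <= n)%N -> A i (Y w (t i))] in
  P event = (\int[m]_x (nestT T n t A x)%:E)%E /\
  (P event <= sqrte (m (A 0%N)) * sqrte (m (A n)) *
     expeR (- ((\sum_(i < n)
        (intrinsic_dist m E D (A i) (A i.+1) * intrinsic_dist m E D (A i) (A i.+1)
           * ((t i.+1 - t i)^-1)%R%:E)) * (2^-1)%:E)))%E.
Proof.
move=> _ dirE locE semT formE trT [_ PY] _ t0 tlt tn mA event.
have m1 : m setT = 1%E by exact: probability_setT.
have A0 : measurable (A 0%N) by exact: mA.
have An : measurable (A n) by exact: mA.
pose v x : R := \1_(A 0%N) x * chainS p t A 0 n x.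
have bv : bm v by apply: bmM; [exact: bm_indic|exact: (bm_chainS p t mA (add0n n))].
have Pe : P event = (\int[m]_x (v x)%:E)%E.
  rewrite PY ?tn//; apply: eq_integral => x _.
  by rewrite /chain (chainE p tlt mA (add0n n))/= EFinM.
split.
  rewrite Pe; have [[mN _] ae] := nestS semT trT tlt mA (add0n n).
  apply: ae_eq_integral => //.
  - by apply/measurable_EFinP; case: bv.
  - exact/measurable_EFinP.
  - by apply: filterS ae => x e _; rewrite /v e.
pose W := (\sum_(i <- iota 0 n) path_action m E D t A i)%E.
have -> : (\sum_(i < n)
    (intrinsic_dist m E D (A i) (A i.+1) * intrinsic_dist m E D (A i) (A i.+1)
       * ((t i.+1 - t i)^-1)%R%:E) = W)%E.
  by rewrite -(big_mkord xpredT (path_action m E D t A)) /index_iota subn0.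
have W0 : (0 <= W)%E.
  rewrite /W big_seq sume_ge0// => i; rewrite mem_iota => /andP[_ i2].
  exact: (path_action_ge0 dirE semT trT formE A tlt).
pose I := \int[m]_x v x; pose I2 := \int[m]_x (v x ^+ 2).
have -> : P event = I%:E.
  by rewrite Pe /I /Rintegral fineK//; exact: integrable_fin_num (bm_integrable m1 bv).
have fm B : measurable B -> m B = (fine (m B))%:E.
  by move=> mB; rewrite fineK//; exact: fin_num_measure.
have vE x : v x = \1_(A 0%N) x * v x.
  by rewrite /v indicE; case: (_ \in _); rewrite ?mul1r ?mul0r.
(* The probability is the inner product of [v] with the indicator of [A 0]: this yields the factor
   in [m (A 0)], and the square root then halves the exponent of the bound on [I2]. *)
have CS : I ^+ 2 <= fine (m (A 0%N)) * I2.
  have := cauchy_schwarz_bm m1 (bm_indic R A0) bv.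
  rewrite -(int_eq _ vE).
  have e x : \1_(A 0%N) x ^+ 2 = \1_(A 0%N) x :> R.
    by rewrite indicE; case: (_ \in _); rewrite ?expr1n ?expr0n.
  by rewrite (int_eq _ e) /Rintegral integral_indic ?setIT.
have bound := chainS_bound dirE semT trT formE locE tlt mA (add0n n).
rewrite -/W -/I2 in bound.
rewrite (fm _ A0) (fm _ An) /=; rewrite (fm _ An) in bound.
set a := fine (m (A 0%N)) in CS *; set b := fine (m (A n)) in bound *.
have a0 : 0 <= a by exact: fine_ge0.
have b0 : 0 <= b by exact: fine_ge0.
have I20 : 0 <= I2 by apply: Rintegral_ge0 => x _; exact: sqr_ge0.
(* An infinite action makes the exponential 0, so [I2], and with it the probability, vanishes. *)
case: W W0 bound => [w| |]//=; last first.
  move=> _; rewrite mul0e lee_fin => I2le.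
  rewrite gt0_mulye ?lte_fin ?invr_gt0//= mule0 lee_fin.
  have : I ^+ 2 <= 0 by apply: (le_trans CS); rewrite mulr_ge0_le0.
  by rewrite real_exprn_even_le0 ?num_real// => /eqP ->.
rewrite !lee_fin => w0 Ib.
have rhs0 : 0 <= Num.sqrt a * Num.sqrt b * expR (- (w * 2^-1)).
  by rewrite !mulr_ge0 ?sqrtr_ge0 ?expR_ge0.
have [I0|I0] := leP I 0; first exact: le_trans I0 rhs0.
rewrite -(@ler_pXn2r _ 2) ?nnegrE ?rhs0 ?(ltW I0)//.
rewrite !exprMn !sqr_sqrtr// -expRM_natl.
have -> : 2 * - (w * 2^-1) = - w by field.
by apply: (le_trans CS); rewrite -mulrA ler_wpM2l// (le_trans Ib)// mulrC.
Qed.
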